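(* Fix $q\in[2,\infty]$ and an integer $n\ge1$. Let $X=(X_1,\ldots,X_n)$ be a random vector uniformly distributed on $B_q^n$. Then for all real numbers $a_1,\ldots,a_n$ and every $p\ge1$, $$A_{p,q,n}\Big\|\sum_{i=1}^n a_iX_i\Big\|_2\le\Big\|\sum_{i=1}^n a_iX_i\Big\|_p\le B_{p,q,n}\Big\|\sum_{i=1}^n a_iX_i\Big\|_2,$$ where $$A_{p,q,n}=\begin{cases}\frac{\beta_{p,q,n}}{\beta_{2,q,n}}\gamma_p,& p\in[1,2)\\ \frac{\|X_1\|_p}{\|X_1\|_2},& p\in[2,\infty)\end{cases}\qquad\text{and}\qquad B_{p,q,n}=\begin{cases}\frac{\|X_1\|_p}{\|X_1\|_2},& p\in[1,2)\\ \frac{\beta_{p,q,n}}{\beta_{2,q,n}}\gamma_p,& p\in[2,\infty).\end{cases}$$ The value of $A_{p,q,n}$ is sharp (the largest possible constant) for $p\in[2,\infty)$, and the value of $B_{p,q,n}$ is sharp (the smallest possible constant) for $p\in[1,2)$.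
   Context: For a real random variable $S$ and $r>0$, $\|S\|_r=(\mathbb{E}|S|^r)^{1/r}$. For $0<q<\infty$, $B_q^n=\{x\in\mathbb{R}^n:\ |x_1|^q+\cdots+|x_n|^q\le1\}$, and $B_\infty^n=[-1,1]^n$. The constants are $$\gamma_p=\sqrt{2}\Big(\frac{\Gamma(\frac{p+1}{2})}{\sqrt{\pi}}\Big)^{1/p},\qquad \beta_{p,q,n}=\left(\frac{\Gamma(n/q+1)}{\Gamma((n+p)/q+1)}\right)^{1/p},$$ where for $q=\infty$ one has $n/q=(n+p)/q=0$, so $\beta_{p,\infty,n}=1$. *)

(* Defs.v *)
From HB Require Import structures.
From mathcomp Require Import all_boot all_order all_algebra.
From mathcomp Require Import all_classical all_reals all_analysis.

Set Implicit Arguments.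
Unset Strict Implicit.
Unset Printing Implicit Defensive.

Import Order.TTheory GRing.Theory Num.Theory.
Import numFieldNormedType.Exports.

Local Open Scope classical_set_scope.
Local Open Scope ring_scope.

Notation Rn R n := (n.-tuple (measurableTypeR R)).

Section lebesgue_measure_Rn.
Context {R : realType}.

Definition Rn_cons n (z : measurableTypeR R * Rn R n) : Rn R n.+1 :=
  [tuple of z.1 :: z.2].

Lemma measurable_Rn_cons n : measurable_fun [set: _] (@Rn_cons n).
Proof. exact: measurable_cons. Qed.

Section step.
Variables (n : nat) (m : {sigma_finite_measure set (Rn R n) -> \bar R}).

Definition Rn_measureS : set (Rn R n.+1) -> \bar R :=
  pushforward (@lebesgue_measure R \x m)%E (@Rn_cons n).

Let Rn_measureS0 : Rn_measureS set0 = 0%E.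
Proof. by rewrite /Rn_measureS /pushforward preimage_set0 measure0. Qed.

Let Rn_measureS_ge0 A : (0 <= Rn_measureS A)%E.
Proof. by rewrite /Rn_measureS /pushforward measure_ge0. Qed.

Let Rn_measureS_sigma_additive : semi_sigma_additive Rn_measureS.
Proof.
move=> F mF tF mUF; rewrite /Rn_measureS /pushforward preimage_bigcup.
have mR A : measurable A -> measurable (@Rn_cons n @^-1` A).
  by move=> mA; rewrite -[X in measurable X]setTI; exact: measurable_Rn_cons.
apply: measure_semi_sigma_additive.
- by move=> k; exact: mR.
- apply/trivIsetP => /= i j _ _ ij; rewrite -preimage_setI.
  by move/trivIsetP : tF => /(_ _ _ _ _ ij) ->//; rewrite preimage_set0.
- by rewrite -preimage_bigcup; exact: mR.
Qed.

HB.instance Definition _ := isMeasure.Build _ _ _ Rn_measureS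
  Rn_measureS0 Rn_measureS_ge0 Rn_measureS_sigma_additive.

Let Rn_measureS_sigma_finite : sigma_finite setT Rn_measureS.
Proof.
have /sigma_finiteP[F [TF ndF Foo]] := sigma_finiteT (@lebesgue_measure R).
have /sigma_finiteP[G [TG ndG Goo]] := sigma_finiteT m.
pose g (t : Rn R n.+1) : measurableTypeR R * Rn R n :=
  (thead t, [tuple of behead t]).
have mg : measurable_fun setT g.
  apply/measurable_fun_pairP; split; first exact: measurable_tnth.
  apply/measurable_fun_tnthP => i.
  rewrite (_ : _ \o _ = (fun t => tnth t (lift ord0 i))).
    exact: measurable_tnth.
  apply/funext => t /=; rewrite tnth_behead; congr tnth.
  by apply: val_inj; rewrite /= inordK /bump ?add1n ?ltnS.
have gK : cancel (@Rn_cons n) g.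
  by case=> x t; congr pair => //; exact: val_inj.
exists (fun k => g @^-1` (F k `*` G k)) => [|k].
  apply/esym; rewrite -subTset => t _.
  have [i _ Fi] : (\bigcup_i F i) (g t).1
    by rewrite -TF.
  have [j _ Gj] : (\bigcup_j G j) (g t).2 by rewrite -TG.
  exists (maxn i j) => //; split.
  - by move: Fi; exact/subsetPset/ndF/leq_maxl.
  - by move: Gj; exact/subsetPset/ndG/leq_maxr.
have [mF Fk] := Foo k; have [mG Gk] := Goo k.
split.
  by rewrite -[X in measurable X]setTI; apply: mg => //; exact: measurableX.
rewrite /Rn_measureS /pushforward (_ : _ @^-1` _ = F k `*` G k).
  by rewrite product_measure1E// lte_mul_pinfty// ge0_fin_numE.
by apply/funext => z; rewrite /preimage /mkset gK.
Qed.

HB.instance Definition _ := @Measure_isSigmaFinite.Build _ _ _ Rn_measureS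
  Rn_measureS_sigma_finite.

End step.

(* Iterated product of the one-dimensional Lebesgue measure; R^0 is a point
   of mass 1. *)
Fixpoint lebesgue_measure_Rn (n : nat) :
    {sigma_finite_measure set (Rn R n) -> \bar R} :=
  match n with
  | 0 => \d_([tuple] : Rn R 0)
  | n'.+1 => Rn_measureS (lebesgue_measure_Rn n')
  end.

Lemma lebesgue_measure_Rn_box n (A : 'I_n -> set (measurableTypeR R)) :
  (forall i, measurable (A i)) ->
  lebesgue_measure_Rn n [set x | forall i, A i (tnth x i)] =
  (\prod_(i < n) @lebesgue_measure R (A i))%E.
Proof.
elim: n A => [|n IHn] A mA.
  rewrite big_ord0 /= diracE mem_set//= => -[].
  by [].
rewrite big_ord_recl /= /Rn_measureS /pushforward.
rewrite (_ : _ @^-1` _ =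
  A ord0 `*` [set x : Rn R n | forall i, A (lift ord0 i) (tnth x i)]).
  rewrite product_measure1E//; first by congr (_ * _)%E; exact: IHn.
  rewrite (_ : [set x | _] = \bigcap_(i in [set: 'I_n])
      (fun x : Rn R n => tnth x i) @^-1` A (lift ord0 i)).
    apply: fin_bigcap_measurable => [|i _]; first exact: finite_finset.
    by rewrite -[X in measurable X]setTI; exact: measurable_tnth.
  by apply/seteqP; split=> x /= h i; [move=> _; exact: h|exact: (h i I)].
apply/seteqP; split=> -[x t] /=.
  move=> h; split; first exact: (h ord0).
  by move=> i; have := h (lift ord0 i); rewrite tnthS.
move=> [/= h0 h] i; case: (unliftP ord0 i) => [j ->|->]; last exact: h0.
by rewrite tnthS.
Qed.

End lebesgue_measure_Rn.

Section lp_ball.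
Context {R : realType}.

(* Meant for 0 < q <= +oo; the value at q = -oo is junk. *)
Definition lp_ball (q : \bar R) (n : nat) : set (Rn R n) :=
  match q with
  | r%:E => [set x | \sum_(i < n) `|tnth x i| `^ r <= 1]
  | +oo%E => [set x | forall i, `|tnth x i| <= 1]
  | -oo%E => set0
  end.

End lp_ball.

Arguments lp_ball {R} q n.

Section uniform.
Context {R : realType} d (T : measurableType d) (P : probability T R) (n : nat).
Local Open Scope ereal_scope.

Definition uniformly_distributed (X : {RV P >-> Rn R n}) (K : set (Rn R n)) :=
  forall A : set (Rn R n), measurable A ->
    distribution P X A =
    lebesgue_measure_Rn n (A `&` K) / lebesgue_measure_Rn n K.

Definition coordinate (X : {RV P >-> Rn R n}) (i : 'I_n) : T -> R :=
  fun w => tnth (X w) i.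

Definition lincomb (a : 'I_n -> R) (X : {RV P >-> Rn R n}) : T -> R :=
  fun w => (\sum_(i < n) a i * coordinate X i w)%R.

Definition rnorm (r : R) (S : T -> R) : \bar R := 'N[P]_r%:E[EFin \o S].

End uniform.

Section constants.
Context {R : realType}.

Definition Gamma (x : R) : R :=
  \int[@lebesgue_measure R]_(t in `]0, +oo[) (t `^ (x - 1) * expR (- t)).

Definition gamma_cst (p : R) : R :=
  Num.sqrt 2 * (Gamma ((p + 1) / 2) / Num.sqrt pi) `^ p^-1.

(* [fine q^-1] is 1/q, and 0 when q = +oo. *)
Definition beta_cst (p : R) (q : \bar R) (n : nat) : R :=
  let q' := fine (q^-1)%E in
  (Gamma (n%:R * q' + 1) / Gamma ((n%:R + p) * q' + 1)) `^ p^-1.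

End constants.

Section moment_constants.
Context {R : realType} d (T : measurableType d) (P : probability T R) (n : nat).
Variables (p : R) (q : \bar R) (n_gt0 : (0 < n)%N) (X : {RV P >-> Rn R n}).
Local Open Scope ereal_scope.

Definition gaussian_ratio : \bar R :=
  (beta_cst p q n / beta_cst 2 q n * gamma_cst p)%:E.

Definition coord_ratio : \bar R :=
  rnorm P p (coordinate X (Ordinal n_gt0)) / rnorm P 2 (coordinate X (Ordinal n_gt0)).

Definition A_cst : \bar R := if (p < 2)%R then gaussian_ratio else coord_ratio.

Definition B_cst : \bar R := if (p < 2)%R then coord_ratio else gaussian_ratio.

End moment_constants.

(* Main.v *)
Require Import Defs.
From HB Require Import structures.
From mathcomp Require Import all_boot all_order all_algebra.
From mathcomp Require Import all_classical all_reals all_analysis.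
From mathcomp Require Import measurable_realfun lebesgue_integral_under ring lra.

Set Implicit Arguments.
Unset Strict Implicit.
Unset Printing Implicit Defensive.

Import Order.TTheory GRing.Theory Num.Theory.
Import numFieldNormedType.Exports.

Local Open Scope classical_set_scope.
Local Open Scope ring_scope.

(** Let Y be a vector with independent coordinates of density proportional to
    exp(-|t|^q), or uniform on [-1, 1] when q = +oo. Writing
    exp(-(|x_1|^q + ... + |x_n|^q)) as the integral of exp(-t) over
    t >= |x_1|^q + ... + |x_n|^q and rescaling the ball of radius t^(1/q) shows
    that E|<a, X>|^p is the p-th power of beta_(p,q,n) times E|<a, Y>|^p
    ([polar_lp_ball], [lp_ball_moment]). The theorem thus reduces to
      |a|^p E|Y_1|^p <= E|<a, Y>|^p <= |a|^p E|s G|^p    for p >= 2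
    and to the reverse inequalities for 1 <= p <= 2, where |a| is the Euclidean
    norm, s^2 the variance of Y_1, and G a standard Gaussian.

    Both inequalities hold for E h(<a, Y>) with any nonnegative even h of
    polynomial growth whose second derivative is nondecreasing in |x|. To allow
    p = 1, this is stated with second differences ([second_difference_mono]).
    The class contains |x|^p for p >= 2 and 1 + x^2 - |x|^p for 1 <= p <= 2; as
    the mean of 1 + x^2 takes the same value in both bounds, the second function
    gives the reverse inequalities ([moment_bounds_ge2], [moment_bounds_le2]).
    The class has two properties. It is stable under h |-> E h(. + a Y_1)
    ([average_admissible]), so that coordinates can be integrated out one at a
    time. And u |-> h (sqrt u) is convex ([second_difference_square_convex]),
    which yields the two basic comparisons.

    - Lower bound: E h(a Y_1 + b Y_2) >= E h(c Y_1) when c^2 = a^2 + b^2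
      ([average_pythagoras_le]). The reflection sigma of the plane that
      exchanges the directions (1, 0) and (a, b) / c turns the integrand of one
      side into that of the other. With F (x, y) = h (c x) + h (c y) and rho the
      density of (Y_1, Y_2), the claim follows from the pointwise inequality
      (F o sigma - F) (rho - rho o sigma) >= 0: for (x', y') = sigma (x, y),
      convexity in the squares makes both factors nonnegative if
      max(|x'|, |y'|) >= max(|x|, |y|), and nonpositive if not.
    - Upper bound: E h(a Y_1) <= E h(a s G) ([average_lq_le_gauss]).
      For q > 2 the density of Y_1 exceeds the Gaussian one exactly on an
      interval of values of |x|; on that interval h lies below the function
      A + B x^2 with which it agrees at the two ends, and outside it lies above
      ([average_le_crossing]). The densities have the same mass and variance,
      hence give the same mean to A + B x^2.

    The bounds for n coordinates follow by induction, two coordinates being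
    merged at each step ([product_mean_ge], [product_mean_le]). The vector
    a = (1, 0, ..., 0) attains the ratio |X_1|_p / |X_1|_2, which makes this
    constant sharp. *)

(** * Change of variables on the line and in the plane *)

Section change_of_variables.
Context {R : realType}.
Local Notation mu := (@lebesgue_measure R).
Implicit Types (a b : R) (f : R -> \bar R).

Let affine a b (x : measurableTypeR R) : measurableTypeR R := a * x + b.

Let measurable_affine a b : measurable_fun setT (affine a b).
Proof. by apply: measurable_funD => //; exact: measurable_funM. Qed.

HB.instance Definition _ a b :=
  isMeasurableFun.Build _ _ _ _ (affine a b) (@measurable_affine a b).

Lemma ge0_integral_affine a b f : a != 0 -> measurable_fun setT f ->
  (forall x, (0 <= f x)%E) ->
  (\int[mu]_x f (a * x + b)%R = `|a|^-1%:E * \int[mu]_x f x)%E.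
Proof.
move=> a0 mf f0.
pose nu := pushforward (@lebesgue_measure R) (affine a b).
have a1 : 0 < `|a| by rewrite normr_gt0.
pose k : {nonneg R} := NngNum (ltW a1).
have muE A : measurable A -> @lebesgue_measure R A = mscale k nu A.
  apply: lebesgue_measure_unique => X [[c d] /= _ <-].
  rewrite /mscale/= /nu /pushforward /=.
  have [dc|cd] := leP d c.
    rewrite set_itv_ge ?bnd_simp -?leNgt// preimage_set0 !measure0 mule0//.
  have [an|ap|/eqP] := ltgtP a 0; last by rewrite (negbTE a0).
  - rewrite (_ : _ @^-1` _ = `[(d - b) / a, (c - b) / a[%classic); last first.
      by apply/seteqP; split=> x /=; rewrite !in_itv/= /affine ler_ndivrMr//
        ltr_ndivlMr// => /andP[? ?]; apply/andP; split; lra.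
    rewrite !lebesgue_measure_itv/= !lte_fin cd ltr_nM2r ?invr_lt0//.
    rewrite ltrBlDr subrK cd -!EFinD -EFinM; congr EFin.
    by rewrite ltr0_norm//; field.
  - rewrite (_ : _ @^-1` _ = `](c - b) / a, (d - b) / a]%classic); last first.
      by apply/seteqP; split=> x /=; rewrite !in_itv/= /affine ler_pdivlMr//
        ltr_pdivrMr// => /andP[? ?]; apply/andP; split; lra.
    rewrite !lebesgue_measure_itv/= !lte_fin cd ltr_pM2r ?invr_gt0//.
    rewrite ltrBlDr subrK cd -!EFinD -EFinM; congr EFin.
    by rewrite gtr0_norm//; field.
rewrite [X in (_ = _ * X)%E](eq_measure_integral (mscale k nu)); last first.
  by move=> A mA _; exact: muE.
rewrite ge0_integral_mscale//= muleA -EFinM mulVf ?normr_eq0// mul1e.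
rewrite ge0_integral_pushforward//.
Qed.
End change_of_variables.

Section reflection.
Context {R : realType}.
Local Notation mu := (@lebesgue_measure R).
Local Notation RR := (measurableTypeR R * measurableTypeR R)%type.

(** For [b != 0], substitute first v = a x + b y for y, and then
    u = b x - a y for x after exchanging the integrals: the two factors
    [`|b|^-1] and [`|b|] cancel. *)
Lemma ge0_integral_reflection (a b : R) (F : RR -> \bar R) :
  a ^+ 2 + b ^+ 2 = 1 -> measurable_fun setT F -> (forall z, (0 <= F z)%E) ->
  (\int[mu]_x \int[mu]_y F (a * x + b * y, b * x - a * y)%R =
   \int[mu]_x \int[mu]_y F (x, y))%E.
Proof.
move=> ab mF F0.
have mFl (u v : measurableTypeR R -> R) : measurable_fun setT u ->
    measurable_fun setT v -> measurable_fun setT (fun x => F (u x, v x)).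
  by move=> mu mv; apply: (measurableT_comp mF); exact: measurable_fun_pair.
have [b0|b0] := eqVneq b 0.
  have a1 : `|a| = 1.
    by apply/eqP; rewrite -(@eqrXn2 _ 2)// expr1n real_normK ?num_real// -ab b0; apply/eqP; ring.
  have a0 : a != 0 by rewrite -normr_eq0 a1 oner_eq0.
  transitivity (\int[mu]_x \int[mu]_y F (a * x + 0, y)%R)%E.
    apply: eq_integral => x _.
    rewrite -[RHS]mul1e -(invr1 R) -a1 -normrN -(@ge0_integral_affine R (- a) 0 (fun y => F (a * x + 0, y)))//.
    - by apply: eq_integral => y _; rewrite b0; congr (F (_, _)); ring.
    - by rewrite oppr_eq0.
    - by apply: mFl.
  rewrite (@ge0_integral_affine R a 0 (fun x => \int[mu]_y F (x, y))%E)//.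
  - by rewrite a1 invr1 mul1e.
  - exact: (@measurable_fun_fubini_tonelli_F _ _ _ _ _ mu F).
  - by move=> x; exact: integral_ge0.
pose G := fun z : RR => F (z.2, (z.1 - a * z.2) / b).
have mG : measurable_fun setT G.
  apply: (measurableT_comp mF); apply: measurable_fun_pair => //=.
  apply: measurable_funM => //; apply: measurable_funB => //.
  exact: measurable_funM.
transitivity (\int[mu]_x (`|b|^-1%:E * \int[mu]_y G (x, y)))%E.
  apply: eq_integral => x _.
  rewrite -(@ge0_integral_affine R b (a * x) (fun y => G (x, y)))//; last 2 first.
  - exact: (measurable_fun_pair2 x mG).
  - by move=> y; exact: F0.
  apply: eq_integral => y _; rewrite /G/=; congr (F (_, _)); first by ring.
  by apply: (mulIf b0); rewrite mulfVK//; have := congr1 (fun t => t * x) ab; rewrite /=; lra.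
have b1 : 0 <= `|b|^-1 by rewrite invr_ge0.
rewrite (ge0_integralZl_EFin mu measurableT _ _ b1); last 2 first.
- by move=> x _; apply: integral_ge0 => y _; exact: F0.
- exact: (@measurable_fun_fubini_tonelli_F _ _ _ _ _ mu G mG (fun z => F0 _)).
rewrite (@fubini_tonelli _ _ _ _ _ mu mu G)//; last by move=> z; exact: F0.
rewrite -(ge0_integralZl_EFin mu measurableT _ _ b1); last 2 first.
- by move=> x _; apply: integral_ge0 => y _; exact: F0.
- exact: (@measurable_fun_fubini_tonelli_G _ _ _ _ _ mu G mG (fun z => F0 _)).
apply: eq_integral => y _.
transitivity (`|b|^-1%:E * \int[mu]_x F (y, b^-1 * x + - (a * y / b))%R)%E.
  by congr *%E; apply: eq_integral => x _; congr (F (_, _)); rewrite /=; field.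
rewrite (@ge0_integral_affine R b^-1 (- (a * y / b)) (fun x => F (y, x)))//.
- by rewrite normfV invrK muleA -EFinM mulVf ?mul1e// normr_eq0.
- by rewrite invr_eq0.
- by apply: mFl.
Qed.
End reflection.

(** * Monotone second differences and convexity in the square *)

Section square_convexity.
Context {R : realType}.
Implicit Types (h : R -> R) (x y z s : R).

Definition even_fun h := forall x, h (- x) = h x.

(** For smooth even [h] this says that the second derivative is nondecreasing in
    [`|x|]; second differences also cover 1 + x^2 - |x|, which has a corner. *)
Definition second_difference_mono h := forall s x y, `|x| <= `|y| ->
  h (x + s) + h (x - s) + 2 * h y <= h (y + s) + h (y - s) + 2 * h x.

(** Convexity of u |-> h (sqrt u), as the chord inequality at the points
    x^2 <= y^2 <= z^2. *)
Definition square_convex h := forall x y z, 0 <= x -> x <= y -> y <= z ->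
  (z ^+ 2 - x ^+ 2) * h y <= (z ^+ 2 - y ^+ 2) * h x + (y ^+ 2 - x ^+ 2) * h z.

(** Subtract from [h] the function A + B v^2 that agrees with it at [x] and [z],
    and suppose that the difference [f] is positive somewhere between. A small
    perturbation f + e (v^2 - z^2) then has an interior maximum, at which the
    second differences of [f] with small steps are negative; by monotonicity
    they are negative at all points of smaller modulus. Hence [f] has no minimum
    inside the symmetric interval ending at that point: its minimum there is the
    positive value at the ends, although [f] vanishes at [x]. *)
Lemma second_difference_square_convex h : even_fun h -> continuous h ->
  second_difference_mono h -> square_convex h.
Proof.
move=> he hc hd x y z x0 xy yz.
have [xz|zx] := ltP x z; last first.
  have xz : x = z by lra.
  have -> : y = x by lra.
  by rewrite xz; lra.
rewrite leNgt; apply/negP => lt_h.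
have d0 : 0 < z ^+ 2 - x ^+ 2 by nra.
pose b := (h z - h x) / (z ^+ 2 - x ^+ 2).
have bE : b * (z ^+ 2 - x ^+ 2) = h z - h x by rewrite mulfVK// gt_eqF.
pose f v := h v - h x - b * (v ^+ 2 - x ^+ 2).
have fx : f x = 0 by rewrite /f; ring.
have fz : f z = 0 by rewrite /f bE; ring.
have fe : even_fun f by move=> v; rewrite /f he sqrrN.
have fd v w s : `|v| <= `|w| ->
    f (v + s) + f (v - s) + 2 * f w <= f (w + s) + f (w - s) + 2 * f v.
  by move=> /(hd s); rewrite /f; lra.
have fy : 0 < f y.
  have -> : f y = ((z ^+ 2 - x ^+ 2) * h y - (z ^+ 2 - y ^+ 2) * h x
      - (y ^+ 2 - x ^+ 2) * h z) / (z ^+ 2 - x ^+ 2).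
    by rewrite /f /b; field; rewrite gt_eqF.
  by rewrite divr_gt0//; lra.
have z1 : 0 < z ^+ 2 + 1 by have := sqr_ge0 z; lra.
(* small enough for fe_ to be positive at y *)
pose e := f y / (z ^+ 2 + 1).
have eE : e * (z ^+ 2 + 1) = f y by rewrite mulfVK// gt_eqF.
have e0 : 0 < e by rewrite divr_gt0.
have ele u : 0 <= u -> u <= z -> e * (u ^+ 2 - z ^+ 2) <= 0.
  by move=> u0 uz; rewrite mulr_ge0_le0 ?(ltW e0)//; nra.
pose fe_ v := f v + e * (v ^+ 2 - z ^+ 2).
have cf : continuous f.
  move=> v; apply: cvgB; first by apply: cvgB; [exact: hc|exact: cvg_cst].
  apply: cvgM; first exact: cvg_cst.
  by apply: cvgB; [exact: exprn_continuous|exact: cvg_cst].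
have cfe : continuous fe_.
  move=> v; apply: cvgD; first exact: cf.
  apply: cvgM; first exact: cvg_cst.
  by apply: cvgB; [exact: exprn_continuous|exact: cvg_cst].
have [|v] := @EVT_max R fe_ x z (ltW xz); first exact: continuous_subspaceT.
rewrite in_itv/= => /andP[xv vz] vmax.
have fev : 0 < fe_ v.
  have yI : y \in `[x, z] by rewrite in_itv/= xy yz.
  by apply: lt_le_trans (vmax _ yI); rewrite /fe_; nra.
have xv' : x < v.
  rewrite lt_neqAle xv andbT; apply/eqP => xE.
  by move: fev; rewrite -xE /fe_ fx; nra.
have vz' : v < z.
  rewrite lt_neqAle vz andbT; apply/eqP => zE.
  by move: fev; rewrite zE /fe_ fz; nra.
have fv : 0 < f v by have := ele v ltac:(lra) vz; move: fev; rewrite /fe_; lra.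
have [||m] := @EVT_min R f (- v) v; first by lra.
  exact: continuous_subspaceT.
rewrite in_itv/= => /andP[vm mv] mmin.
have fm : f m <= 0.
  by rewrite -fx; apply: mmin; rewrite in_itv/=; lra.
have mv' : `|m| < v.
  rewrite lt_neqAle ler_norml vm mv !andbT; apply/eqP => mE.
  have : f m = f v.
    by rewrite -mE; case: (ger0P m) => _ //; rewrite fe.
  lra.
pose s := Num.min (Num.min (v - x) (z - v)) (v - `|m|).
have s0 : 0 < s by rewrite !lt_min; apply/andP; split; [apply/andP; split|]; lra.
have [s1 s2 s3] : [/\ s <= v - x, s <= z - v & s <= v - `|m|].
  by rewrite /s !ge_min !lexx !orbT.
have m1 : m <= `|m| := ler_norm m.
have m2 : - m <= `|m| by rewrite -normrN ler_norm.
have := @fd m v s; rewrite (gtr0_norm (le_lt_trans x0 xv')) => /(_ (ltW mv')).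
have : f m <= f (m + s) by apply: mmin; rewrite in_itv/=; lra.
have : f m <= f (m - s) by apply: mmin; rewrite in_itv/=; lra.
have : fe_ (v + s) <= fe_ v by apply: vmax; rewrite in_itv/=; lra.
have : fe_ (v - s) <= fe_ v by apply: vmax; rewrite in_itv/=; lra.
have : 0 < e * s ^+ 2 by rewrite mulr_gt0// exprn_gt0.
by rewrite /fe_; lra.
Qed.

(** Majorization: (x^2, y^2) is majorized by (x'^2, y'^2). *)
Lemma square_convex_four_points h x y x' y' : even_fun h -> square_convex h ->
  x ^+ 2 + y ^+ 2 = x' ^+ 2 + y' ^+ 2 ->
  Num.max `|x| `|y| <= Num.max `|x'| `|y'| -> h x + h y <= h x' + h y'.
Proof.
move=> he hc.
have hn v : h `|v| = h v by case: (ger0P v) => _ //; rewrite he.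
rewrite -(hn x) -(hn y) -(hn x') -(hn y').
rewrite -(real_normK (num_real x)) -(real_normK (num_real y)).
rewrite -(real_normK (num_real x')) -(real_normK (num_real y')).
move: `|x| `|y| `|x'| `|y'| (normr_ge0 x) (normr_ge0 y) (normr_ge0 x')
  (normr_ge0 y') => {}x {}y {}x' {}y'.
wlog xy : x y / y <= x.
  move=> W; have /orP[|] := le_total y x; first exact: W.
  move=> xy x0 y0 x'0 y'0 E xm; rewrite (addrC (h x)).
  by apply: W => //; [rewrite addrC|rewrite maxC].
wlog xy' : x' y' / y' <= x'.
  move=> W; have /orP[|] := le_total y' x'; first exact: W.
  move=> xy' x0 y0 x'0 y'0 E xm; rewrite (addrC (h x')).
  by apply: W => //; [rewrite E addrC|rewrite (maxC y')].
move=> x0 y0 x'0 y'0 E; rewrite !max_l// => xx'.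
have yy' : y' <= y by rewrite -(ler_pXn2r (n := 2)) ?nnegrE//; nra.
have [x'y'|] := ltP (y' ^+ 2) (x' ^+ 2); last first.
  move=> le'; have ee : x' = y' by apply/eqP; rewrite -(@eqrXn2 _ 2)//; nra.
  have ex : x = x' by lra.
  have -> : y = y' by apply/eqP; rewrite -(@eqrXn2 _ 2)//; apply/eqP; rewrite ex in E; lra.
  by rewrite ex.
have H1 := hc y' y x' y'0 yy' (le_trans xy xx').
have H2 := hc y' x x' y'0 (le_trans yy' xy) xx'.
have d0 : 0 < x' ^+ 2 - y' ^+ 2 by lra.
rewrite -(ler_pM2l d0).
have E2 : y ^+ 2 = x' ^+ 2 + y' ^+ 2 - x ^+ 2 by lra.
rewrite E2 in H1; move: H1 H2; lra.
Qed.

Lemma square_convex_scale h c : even_fun h -> square_convex h ->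
  square_convex (fun x => h (c * x)).
Proof.
move=> he hc; have [->|c0] := eqVneq c 0.
  by move=> x y z x0 xy yz; rewrite !mul0r; lra.
have c1 : 0 < `|c| by rewrite normr_gt0.
have c2 : 0 < `|c| ^+ 2 by rewrite exprn_gt0.
have kE u : 0 <= u -> h (c * u) = h (`|c| * u).
  by move=> u0; case: (ger0P c) => _ //; rewrite mulNr he.
move=> x y z x0 xy yz; rewrite !kE//; [|lra..].
have := hc (`|c| * x) (`|c| * y) (`|c| * z).
rewrite !ler_pM2l// !exprMn => /(_ (mulr_ge0 (ltW c1) x0) xy yz) HH.
rewrite -(ler_pM2l c2); lra.
Qed.

End square_convexity.

(** * Powers of the absolute value *)

Section powers.
Context {R : realType}.
Implicit Types (x y z s p r c : R).

(** Bernoulli's inequality: with L = ln x, add the bounds 1 + t <= exp t for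
    t = (1 - r) L and t = - r L with weights [r] and [1 - r]. *)
Lemma powR_le_affine x r : 0 <= x -> 0 < r <= 1 -> x `^ r <= 1 + r * (x - 1).
Proof.
move=> x0 /andP[r0 r1]; have [->|xn0] := eqVneq x 0.
  by rewrite powR0 ?gt_eqF//; lra.
rewrite /powR (negbTE xn0); set L := ln x.
have -> : x = expR L by rewrite lnK// posrE lt_neqAle eq_sym xn0.
have H1 : 1 + (1 - r) * L <= expR L * expR (- (r * L)).
  by rewrite -expRD (_ : L + _ = (1 - r) * L) ?expR_ge1Dx//; ring.
have H2 : 1 - r * L <= expR (- (r * L)) by exact: expR_ge1Dx.
have E0 : 0 < expR (r * L) := expR_gt0 _.
have E1 : expR (r * L) * expR (- (r * L)) = 1 by rewrite -expRD subrr expR0.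
suff : 1 <= (1 + r * (expR L - 1)) * expR (- (r * L)).
  by move=> H; rewrite -[leLHS]mulr1 -(ler_pM2r (expR_gt0 (- (r * L)))) mulr1 E1.
have := ler_wpM2l (ltW r0) H1.
have := ler_wpM2l (_ : 0 <= 1 - r) H2 => /(_ ltac:(lra)).
lra.
Qed.

Lemma powR_ge_affine x r : 0 <= x -> 1 <= r -> 1 + r * (x - 1) <= x `^ r.
Proof.
move=> x0 r1; have r0 : 0 < r by lra.
have := @powR_le_affine (x `^ r) r^-1 (powR_ge0 _ _).
rewrite -powRrM mulfV ?gt_eqF// powRr1// invr_gt0 r0 invf_le1// => /(_ r1).
by move/(ler_wpM2l (ltW r0)); rewrite mulrDr mulrA mulfV ?gt_eqF//; lra.
Qed.

Let powR_frac x y r : 0 <= x -> 0 < x + y -> x `^ r = (x + y) `^ r * (x / (x + y)) `^ r.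
Proof.
move=> x0 xy; rewrite -powRM ?divr_ge0 ?(ltW xy)//.
by congr (_ `^ _); field; rewrite gt_eqF.
Qed.

Let frac01 x y : 0 < x -> 0 <= y -> 0 < x / (x + y) <= 1.
Proof.
by move=> x0 y0; rewrite divr_gt0 ?ltr_wpDr// ler_pdivrMr ?mul1r ?lerDl// ltr_wpDr.
Qed.

Lemma powR_superadditive x y r : 0 < x -> 0 < y -> 1 <= r ->
  x `^ r + y `^ r <= (x + y) `^ r.
Proof.
move=> x0 y0 r1; have xy : 0 < x + y by exact: addr_gt0.
rewrite (powR_frac _ (ltW x0) xy) [y `^ r](@powR_frac y x) ?(ltW y0)//; last by rewrite addrC.
rewrite (addrC y x) -mulrDr ler_piMr ?powR_ge0//.
have := ge1r_powR (frac01 x0 (ltW y0)) r1.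
have := ge1r_powR (frac01 y0 (ltW x0)) r1.
rewrite (addrC y x).
have : x / (x + y) + y / (x + y) = 1 by field; rewrite gt_eqF.
lra.
Qed.

Lemma powR_subadditive x y r : 0 < x -> 0 < y -> 0 <= r <= 1 ->
  (x + y) `^ r <= x `^ r + y `^ r.
Proof.
move=> x0 y0 /andP[r0 r1]; have xy : 0 < x + y by exact: addr_gt0.
rewrite (powR_frac _ (ltW x0) xy) [y `^ r](@powR_frac y x) ?(ltW y0)//; last by rewrite addrC.
rewrite (addrC y x) -mulrDr ler_peMr ?powR_ge0//.
have := ger1_powR (frac01 x0 (ltW y0)) r1.
have := ger1_powR (frac01 y0 (ltW x0)) r1.
rewrite (addrC y x).
have : x / (x + y) + y / (x + y) = 1 by field; rewrite gt_eqF.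
lra.
Qed.

Definition abs_pow p x := `|x| `^ p.

Lemma abs_pow_even p : even_fun (abs_pow p).
Proof. by move=> x; rewrite /abs_pow normrN. Qed.

Lemma is_derive_abs_pow p c : c != 0 ->
  is_derive c 1 (abs_pow p) (p * (Num.sg c * `|c| `^ (p - 1))).
Proof.
move=> c0; have [cp|cn|/eqP] := ltgtP c 0; last by rewrite (negbTE c0).
- rewrite ltr0_sg// ltr0_norm//.
  have D : is_derive c 1 ((fun x : R => x `^ p) \o (-%R : R -> R)) (p * (-1 * (- c) `^ (p - 1))).
    have Nc : 0 < - c by rewrite oppr_gt0.
    have -> : p * (-1 * (- c) `^ (p - 1)) = (p * (- c) `^ (p - 1)) * -1 by ring.
    exact: (@is_derive1_comp R (fun x : R => x `^ p) (-%R : R -> R) c _ _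
      (is_derive1_powR p Nc) (is_deriveNid _ _)).
  apply: (near_eq_is_derive _ D).
  near=> x; rewrite /abs_pow/= ltr0_norm//; near: x; exact: lt_nbhsl.
- rewrite gtr0_sg// gtr0_norm// mul1r.
  apply: (near_eq_is_derive _ (is_derive1_powR p cn)).
  near=> x; rewrite /abs_pow gtr0_norm//; near: x; exact: lt_nbhsr.
Unshelve. all: by end_near. Qed.

Lemma continuous_abs_pow p : 0 < p -> continuous (abs_pow p).
Proof.
move=> p0 x; have [->|x0] := eqVneq x 0; last first.
  have D := is_derive_abs_pow p x0.
  by apply: differentiable_continuous; apply/derivable1_diffP; exact: ex_derive.
apply/cvgrPdist_le => /= e e0; near=> t.
rewrite /abs_pow normr0 powR0 ?gt_eqF// sub0r normrN ger0_norm ?powR_ge0//.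
have -> : e = (e `^ p^-1) `^ p by rewrite -powRrM mulVf ?gt_eqF// powRr1// ltW.
apply: ge0_ler_powR; rewrite ?nnegrE ?powR_ge0 ?(ltW p0)//.
near: t; apply: (@nbhs0_le _ R^o); exact: powR_gt0.
Unshelve. all: by end_near. Qed.

(** The second difference of |x|^p with step [s] is not differentiable at [s]
    when [p = 1], which is why one point is left out. *)
Lemma nondecreasing_off_point (f df : R -> R) s : continuous f ->
  (forall c, 0 < c -> c != s -> is_derive c 1 f (df c)) ->
  (forall c, 0 < c -> c != s -> 0 <= df c) ->
  forall x y, 0 <= x -> x <= y -> f x <= f y.
Proof.
move=> cf dfE df0.
have step x y : 0 <= x -> x <= y -> (y <= s \/ s <= x) -> f x <= f y.
  move=> x0; rewrite le_eqVlt => /predU1P[->//|xy] ss.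
  have cs c : c \in `]x, y[ -> 0 < c /\ c != s.
    rewrite in_itv/= => /andP[xc cy]; split; first lra.
    by apply/eqP => cs; case: ss; lra.
  have [| |c /cs[c0 csn] E] := @MVT R f df x y xy.
  - by move=> c /cs[? ?]; exact: dfE.
  - exact: continuous_subspaceT.
  by rewrite -subr_ge0 E mulr_ge0 ?df0//; lra.
move=> x y x0 xy; have [sx|xs] := leP s x; first by apply: step => //; right.
have [ys|sy] := leP y s; first by apply: step => //; left.
apply: (@le_trans _ _ (f s)).
  by apply: step => //; [exact: ltW|left].
by apply: step; [lra|exact: ltW|right].
Qed.

Let second_diff p s x := abs_pow p (x + s) + abs_pow p (x - s) - 2 * abs_pow p x.

Let slope p s c := p * (Num.sg (c + s) * `|c + s| `^ (p - 1)) +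
  p * (Num.sg (c - s) * `|c - s| `^ (p - 1)) - 2 * (p * (Num.sg c * `|c| `^ (p - 1))).

Let is_derive_second_diff p s c : 0 <= s -> 0 < c -> c != s ->
  is_derive c 1 (second_diff p s) (slope p s c).
Proof.
move=> s0 c0 cs.
have sh t : c + t != 0 -> is_derive c 1 (fun x => abs_pow p (x + t))
    (p * (Num.sg (c + t) * `|c + t| `^ (p - 1))).
  move=> ct; rewrite -[X in is_derive _ _ _ X]mulr1.
  have D : is_derive c 1 (fun x : R => x + t) 1.
    by apply: is_derive_eq; rewrite addr0.
  exact: (@is_derive1_comp R (abs_pow p) (fun x => x + t) c _ _
    (is_derive_abs_pow p ct) D).
apply: is_deriveB.
  apply: is_deriveD; apply: sh; first by rewrite gt_eqF// ltr_wpDr.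
  by rewrite subr_eq0.
by apply: is_deriveZ; apply: is_derive_abs_pow; rewrite gt_eqF.
Qed.

Let continuous_second_diff p s : 0 < p -> continuous (second_diff p s).
Proof.
move=> p0 x; have cp := continuous_abs_pow p0.
apply: cvgB; last by apply: cvgM; [exact: cvg_cst|exact: cp].
have sh t : (abs_pow p (y + t)) @[y --> x] --> abs_pow p (x + t).
  apply: (cvg_comp (fun y => y + t) (abs_pow p)); last exact: cp.
  by apply: cvgD; [exact: cvg_id|exact: cvg_cst].
by apply: cvgD; exact: sh.
Qed.

(** For [c < s] this is superadditivity of t^(p-1) at [s - c] and [2 * c]; for
    [s < c] it is midpoint convexity, from the tangent at [c]. *)
Let slope_ge0 p s c : 2 <= p -> 0 <= s -> 0 < c -> c != s -> 0 <= slope p s c.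
Proof.
move=> p2 s0 c0 cs; have r1 : 1 <= p - 1 by lra.
have -> : slope p s c = p * (Num.sg (c + s) * `|c + s| `^ (p - 1) +
   Num.sg (c - s) * `|c - s| `^ (p - 1) - 2 * (Num.sg c * `|c| `^ (p - 1))).
  by rewrite /slope; ring.
have cs0 : 0 < c + s by lra.
apply: mulr_ge0; first lra.
rewrite !(gtr0_sg cs0, gtr0_sg c0, gtr0_norm cs0, gtr0_norm c0) !mul1r.
have [cs'|sc|/eqP] := ltgtP c s; last by rewrite (negbTE cs).
- have d0 : c - s < 0 by lra.
  rewrite (ltr0_sg d0) (ltr0_norm d0) opprB.
  have := @powR_superadditive (s - c) (2 * c) (p - 1) ltac:(lra) ltac:(lra) r1.
  rewrite (_ : s - c + 2 * c = c + s); last by ring.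
  rewrite powRM ?(ltW c0)//.
  have : 2 <= 2 `^ (p - 1) by apply: le1r_powR => //; rewrite ler1n.
  have := powR_ge0 c (p - 1).
  nra.
- have d0 : 0 < c - s by lra.
  rewrite (gtr0_sg d0) (gtr0_norm d0) mul1r.
  have t1 : 0 <= (c + s) / c by rewrite divr_ge0// ltW.
  have t2 : 0 <= (c - s) / c by rewrite divr_ge0// ltW.
  have -> : c + s = c * ((c + s) / c) by field; rewrite gt_eqF.
  have -> : c - s = c * ((c - s) / c) by field; rewrite gt_eqF.
  rewrite (powRM _ (ltW c0) t1) (powRM _ (ltW c0) t2).
  have := powR_ge_affine t1 r1.
  have := powR_ge_affine t2 r1.
  have : (c + s) / c - 1 + ((c - s) / c - 1) = 0 by field; rewrite gt_eqF.
  have := powR_ge0 c (p - 1).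
  set A := c `^ _; set u := (c + s) / c; set v := (c - s) / c.
  set B := u `^ _; set C := v `^ _ => A0 E Hv Hu.
  have : 0 <= B + C - 2.
    have : (p - 1) * (u - 1 + (v - 1)) = 0 by rewrite E mulr0.
    lra.
  by move/(mulr_ge0 A0); lra.
Qed.

Let slope_le0 p s c : 1 <= p <= 2 -> 0 <= s -> 0 < c -> c != s -> slope p s c <= 0.
Proof.
move=> /andP[p1 p2] s0 c0 cs.
have -> : slope p s c = p * (Num.sg (c + s) * `|c + s| `^ (p - 1) +
   Num.sg (c - s) * `|c - s| `^ (p - 1) - 2 * (Num.sg c * `|c| `^ (p - 1))).
  by rewrite /slope; ring.
have cs0 : 0 < c + s by lra.
apply: mulr_ge0_le0; first lra.
rewrite !(gtr0_sg cs0, gtr0_sg c0, gtr0_norm cs0, gtr0_norm c0) !mul1r.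
have [cs'|sc|/eqP] := ltgtP c s; last by rewrite (negbTE cs).
- have d0 : c - s < 0 by lra.
  rewrite (ltr0_sg d0) (ltr0_norm d0) opprB.
  have := @powR_subadditive (s - c) (2 * c) (p - 1) ltac:(lra) ltac:(lra) ltac:(lra).
  rewrite (_ : s - c + 2 * c = c + s); last by ring.
  rewrite powRM ?(ltW c0)//.
  have : 2 `^ (p - 1) <= 2 by apply: ler1_powR; [rewrite ler1n|lra].
  have := powR_ge0 c (p - 1).
  nra.
- have d0 : 0 < c - s by lra.
  rewrite (gtr0_sg d0) (gtr0_norm d0) mul1r.
  have [->|pn1] := eqVneq p 1; first by rewrite subrr !powRr0; lra.
  have r1 : 0 < p - 1 <= 1.
    by rewrite subr_gt0 lt_neqAle eq_sym pn1 p1/=; lra.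
  have t1 : 0 <= (c + s) / c by rewrite divr_ge0// ltW.
  have t2 : 0 <= (c - s) / c by rewrite divr_ge0// ltW.
  have -> : c + s = c * ((c + s) / c) by field; rewrite gt_eqF.
  have -> : c - s = c * ((c - s) / c) by field; rewrite gt_eqF.
  rewrite (powRM _ (ltW c0) t1) (powRM _ (ltW c0) t2).
  have := powR_le_affine t1 r1.
  have := powR_le_affine t2 r1.
  have : (c + s) / c - 1 + ((c - s) / c - 1) = 0 by field; rewrite gt_eqF.
  have := powR_ge0 c (p - 1).
  set A := c `^ _; set u := (c + s) / c; set v := (c - s) / c.
  set B := u `^ _; set C := v `^ _ => A0 E Hv Hu.
  have : B + C - 2 <= 0.
    have : (p - 1) * (u - 1 + (v - 1)) = 0 by rewrite E mulr0.
    lra.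
  by move/(mulr_ge0_le0 A0); lra.
Qed.

Let second_diff_abs p s x : second_diff p `|s| `|x| = second_diff p s x.
Proof.
have sE v : second_diff p `|s| v = second_diff p s v.
  by case: (ger0P s) => // _; rewrite /second_diff opprK (addrC (abs_pow p (v - s))).
rewrite sE; case: (ger0P x) => // _; rewrite /second_diff.
rewrite (_ : - x + s = - (x - s)); last by ring.
rewrite (_ : - x - s = - (x + s)); last by ring.
by rewrite !abs_pow_even (addrC (abs_pow p (x - s))).
Qed.

Lemma abs_pow_second_difference p : 2 <= p -> second_difference_mono (abs_pow p).
Proof.
move=> p2 s x y xy.
have p0 : 0 < p by lra.
have := @nondecreasing_off_point (second_diff p `|s|) (slope p `|s|) `|s|
  _ _ _ _ _ (normr_ge0 x) xy.
rewrite !second_diff_abs /second_diff => H.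
suff : abs_pow p (x + s) + abs_pow p (x - s) - 2 * abs_pow p x <=
  abs_pow p (y + s) + abs_pow p (y - s) - 2 * abs_pow p y by lra.
apply: H.
- exact: continuous_second_diff.
- by move=> c c0 cs; exact: is_derive_second_diff.
- by move=> c c0 cs; exact: slope_ge0.
Qed.

(** For these [p] the second differences of |x|^p are nonincreasing instead;
    adding 1 + x^2 to the opposite restores nonnegativity and changes second
    differences by a constant only. *)
Lemma sqr_sub_abs_pow_second_difference p : 1 <= p <= 2 ->
  second_difference_mono (fun x => 1 + x ^+ 2 - abs_pow p x).
Proof.
move=> p12 s x y xy.
have p0 : 0 < p by lra.
have := @nondecreasing_off_point (\- second_diff p `|s|) (\- slope p `|s|) `|s| _ _ _ _ _ (normr_ge0 x) xy.
rewrite /= !second_diff_abs /second_diff => H.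
suff : - (abs_pow p (x + s) + abs_pow p (x - s) - 2 * abs_pow p x) <=
  - (abs_pow p (y + s) + abs_pow p (y - s) - 2 * abs_pow p y) by lra.
apply: H.
- by move=> z; apply: cvgN; exact: continuous_second_diff.
- move=> c c0 cs; apply: is_deriveN; exact: is_derive_second_diff.
- by move=> c c0 cs; rewrite oppr_ge0 slope_le0.
Qed.

Lemma abs_pow_square_convex p : 2 <= p -> square_convex (abs_pow p).
Proof.
move=> p2; apply: second_difference_square_convex; first exact: abs_pow_even.
  by apply: continuous_abs_pow; lra.
exact: abs_pow_second_difference.
Qed.

End powers.

(** * Averages against an even unimodal density *)

Section averages.
Context {R : realType}.
Local Notation mu := (@lebesgue_measure R).
Implicit Types (w h f g : R -> R) (a r x y z s : R).

Definition rintegrable f := mu.-integrable setT (EFin \o f).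

Lemma ge0_rintegrable f g : measurable_fun setT f ->
  (forall x, 0 <= f x <= g x) -> rintegrable g -> rintegrable f.
Proof.
move=> mf fg; apply: le_integrable => //; first exact/measurable_EFinP.
move=> x _ /=; rewrite lee_fin.
by have /andP[f0 fgx] := fg x; rewrite !ger0_norm// (le_trans f0).
Qed.

Lemma rintegrableD f g : rintegrable f -> rintegrable g ->
  rintegrable (fun x => f x + g x).
Proof. by move=> fi gi; have := integrableD measurableT fi gi. Qed.

Lemma rintegrableB f g : rintegrable f -> rintegrable g ->
  rintegrable (fun x => f x - g x).
Proof. by move=> fi gi; have := integrableB measurableT fi gi. Qed.

Lemma rintegrableZ k f : rintegrable f -> rintegrable (fun x => k * f x).
Proof. by move=> fi; have := integrableZl measurableT k fi. Qed.

Lemma rintegrable_measurable f : rintegrable f -> measurable_fun setT f.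
Proof. by move=> /integrableP[/measurable_EFinP]. Qed.

Lemma EFin_Rintegral f : rintegrable f ->
  ((\int[mu]_x f x)%:E = \int[mu]_x (f x)%:E)%E.
Proof. by move=> fi; rewrite fineK//; exact: integrable_fin_num. Qed.

Lemma rintegrable_affine a b f : a != 0 -> rintegrable f ->
  rintegrable (fun x => f (a * x + b)).
Proof.
move=> a0 /integrableP[/measurable_EFinP mf foo].
have ml : measurable_fun setT (fun x : R => a * x + b).
  by apply: measurable_funD => //; exact: measurable_funM.
apply/integrableP; split.
  by apply/measurable_EFinP; exact: measurableT_comp.
have := @ge0_integral_affine R a b (fun x => `|(f x)%:E|)%E a0.
rewrite /= => ->//; first by rewrite lte_mul_pinfty// lee_fin invr_ge0.
by apply/measurable_EFinP; exact: measurableT_comp.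
Qed.

Lemma Rintegral_affine a b f : a != 0 -> measurable_fun setT f ->
  (forall x, 0 <= f x) ->
  \int[mu]_x f (a * x + b) = `|a|^-1 * \int[mu]_x f x.
Proof.
move=> a0 mf f0; rewrite /Rintegral.
rewrite (@ge0_integral_affine R a b (fun x => (f x)%:E))//; last exact/measurable_EFinP.
have : (0 <= \int[mu]_x (f x)%:E)%E by apply: integral_ge0 => x _; rewrite lee_fin.
case: (\int[mu]_x (f x)%:E)%E => [v| |] //= _.
by rewrite gt0_muley ?lte_fin ?invr_gt0 ?normr_gt0// mulr0.
Qed.

Record weight w : Prop := Weight {
  weight_measurable : measurable_fun setT w ;
  weight_ge0 : forall x, 0 <= w x ;
  weight_even : even_fun w ;
  weight_noninc : forall x y, `|x| <= `|y| -> w y <= w x ;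
  weight_moment : forall r, 0 <= r -> rintegrable (fun x => (1 + `|x|) `^ r * w x) ;
  weight_mass : \int[mu]_x w x = 1 }.

(** The growth bound keeps averages finite, and nonnegativity lets integrals be
    exchanged freely. *)
Record admissible r h : Prop := Admissible {
  admissible_even : even_fun h ;
  admissible_continuous : continuous h ;
  admissible_ge0 : forall x, 0 <= h x ;
  admissible_growth : exists2 K, 0 <= K & forall x, h x <= K * (1 + `|x|) `^ r ;
  admissible_second_difference : second_difference_mono h }.

Lemma admissible_measurable r h : admissible r h -> measurable_fun setT h.
Proof. by move=> /admissible_continuous; exact: continuous_measurable_fun. Qed.

Lemma growth_affine r a y x : 0 <= r ->
  (1 + `|y + a * x|) `^ r <= (1 + `|y|) `^ r * ((1 + `|a|) `^ r * (1 + `|x|) `^ r).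
Proof.
move=> r0; have p1 u : 0 <= 1 + `|u| :> R by rewrite addr_ge0.
rewrite -!powRM// ?mulr_ge0//; apply: ge0_ler_powR; rewrite ?nnegrE ?mulr_ge0//.
have := ler_normD y (a * x); rewrite normrM.
have := normr_ge0 y; have := normr_ge0 a; have := normr_ge0 x.
move: `|_| `|x| `|a| `|y| => n X A Y X0 A0 Y0 H.
have := mulr_ge0 Y0 X0; have := mulr_ge0 Y0 A0; have := mulr_ge0 A0 X0.
have := mulr_ge0 Y0 (mulr_ge0 A0 X0); lra.
Qed.

(** The mean of h (y + a Y) for a variable Y of density [w]. *)
Definition average w a h y := \int[mu]_x (h (y + a * x) * w x).

Section closure.
Variables (w : R -> R) (r : R).
Hypotheses (W : weight w) (r0 : 0 <= r).

Lemma average_bound h K a y x : 0 <= K -> (forall x, h x <= K * (1 + `|x|) `^ r) ->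
  h (y + a * x) * w x <=
  (K * (1 + `|y|) `^ r * (1 + `|a|) `^ r) * ((1 + `|x|) `^ r * w x).
Proof.
move=> K0 hK; rewrite mulrA ler_wpM2r ?(weight_ge0 W)//.
apply: le_trans (hK _) _; rewrite -!mulrA ler_wpM2l//.
exact: growth_affine.
Qed.

Lemma average_integrable h a y : admissible r h ->
  rintegrable (fun x => h (y + a * x) * w x).
Proof.
move=> H; have [K K0 hK] := admissible_growth H.
apply: (@ge0_rintegrable _ (fun x =>
  (K * (1 + `|y|) `^ r * (1 + `|a|) `^ r) * ((1 + `|x|) `^ r * w x))).
- apply: measurable_funM; last exact: weight_measurable.
  apply: (measurableT_comp (f := h)).
    exact: (admissible_measurable H).
  by apply: measurable_funD => //; exact: measurable_funM.
- move=> x; rewrite mulr_ge0 ?(admissible_ge0 H) ?(weight_ge0 W)//=.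
  exact: average_bound.
- by apply: rintegrableZ; exact: weight_moment.
Qed.

Lemma average0 h y : admissible r h -> average w 0 h y = h y.
Proof.
move=> H; rewrite -[RHS]mulr1 -(weight_mass W) -RintegralZl//.
  by apply: eq_Rintegral => x _; rewrite mul0r addr0.
have := weight_moment W (lexx 0).
by under [X in rintegrable X]eq_fun do rewrite powRr0 mul1r.
Qed.

Lemma average_even h a : admissible r h -> even_fun (average w a h).
Proof.
move=> H y; rewrite /average.
have := @Rintegral_affine (-1) 0 (fun x => h (y + a * x) * w x).
rewrite oppr_eq0 oner_eq0 normrN1 invr1 mul1r => <-//.
- apply: eq_Rintegral => x _; rewrite addr0 mulN1r (weight_even W); congr (_ * _).
  by rewrite -(admissible_even H); congr h; ring.
- exact: (rintegrable_measurable (average_integrable _ _ H)).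
- by move=> x; rewrite mulr_ge0 ?(admissible_ge0 H) ?(weight_ge0 W).
Qed.

Lemma average_continuous h a : admissible r h -> continuous (average w a h).
Proof.
move=> H y0; have [K K0 hK] := admissible_growth H.
suff: {in `]y0 - 1, y0 + 1[%classic, continuous (average w a h)}.
  by apply; rewrite inE/= in_itv/=; lra.
apply: (@continuity_under_integral R _ _ mu (fun y x => h (y + a * x) * w x) setT
  measurableT (y0 - 1) (y0 + 1) _ _ (fun x =>
  (K * (2 + `|y0|) `^ r * (1 + `|a|) `^ r) * ((1 + `|x|) `^ r * w x))).
- by move=> x _; exact: average_integrable.
- apply: aeW => x _ z _; apply: cvgM; last exact: cvg_cst.
  apply: (cvg_comp (fun z => z + a * x) h); last exact: (admissible_continuous H).
  by apply: cvgD; [exact: cvg_id|exact: cvg_cst].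
- by apply: rintegrableZ; exact: weight_moment.
move=> z; rewrite /= in_itv/= => zI; apply: aeW => x _.
rewrite ger0_norm ?mulr_ge0 ?(admissible_ge0 H) ?(weight_ge0 W)//.
apply: le_trans (average_bound _ _ _ K0 hK) _.
rewrite ler_wpM2r ?mulr_ge0 ?powR_ge0 ?(weight_ge0 W)//.
rewrite ler_wpM2r ?powR_ge0// ler_wpM2l//.
apply: ge0_ler_powR; rewrite ?nnegrE ?addr_ge0//.
have -> : z = (z - y0) + y0 by ring.
have := ler_normD (z - y0) y0.
have : `|z - y0| <= 1 by rewrite ler_norml; lra.
lra.
Qed.

Lemma average_ge0 h a : admissible r h -> forall y, 0 <= average w a h y.
Proof.
move=> H y; apply: Rintegral_ge0 => x _.
by rewrite mulr_ge0 ?(admissible_ge0 H) ?(weight_ge0 W).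
Qed.

Lemma average_growth h a : admissible r h ->
  exists2 K, 0 <= K & forall y, average w a h y <= K * (1 + `|y|) `^ r.
Proof.
move=> H; have [K K0 hK] := admissible_growth H.
exists (K * (1 + `|a|) `^ r * \int[mu]_x ((1 + `|x|) `^ r * w x)).
  rewrite !mulr_ge0 ?powR_ge0//; apply: Rintegral_ge0 => x _.
  by rewrite mulr_ge0 ?powR_ge0 ?(weight_ge0 W).
move=> y; rewrite mulrAC.
rewrite [X in X * _](_ : _ = K * (1 + `|y|) `^ r * (1 + `|a|) `^ r); last by ring.
have Im := weight_moment W r0.
rewrite -RintegralZl//; apply: le_Rintegral => //.
- exact: average_integrable.
- exact: rintegrableZ.
- by move=> x _; exact: average_bound.
Qed.

Lemma second_difference_mono_nonneg h : even_fun h ->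
  (forall s x y, 0 <= x -> x <= y ->
    h (x + s) + h (x - s) + 2 * h y <= h (y + s) + h (y - s) + 2 * h x) ->
  second_difference_mono h.
Proof.
move=> he hd s x y xy.
have sE v : h (`|v| + s) + h (`|v| - s) = h (v + s) + h (v - s).
  case: (ger0P v) => // _; rewrite (_ : - v + s = - (v - s)); last by ring.
  by rewrite (_ : - v - s = - (v + s)) ?he 1?addrC//; ring.
have nE v : h `|v| = h v by case: (ger0P v) => _ //; rewrite he.
by have := hd s _ _ (normr_ge0 x) xy; rewrite !sE !nE.
Qed.

(** Let d be the second difference of [h] with step [s], and D that of its
    average. For [a != 0] and 0 <= x <= y the substitution [refl] exchanges
    d (y + a z) and d (x + a z), so that 2 (D y - D x) is the integral of
    (d (y + a z) - d (x + a z)) (w z - w (refl z)). Both factors are nonnegative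
    if x + y + 2 a z >= 0, and nonpositive if not. *)
Lemma average_second_difference h a : admissible r h ->
  second_difference_mono (average w a h).
Proof.
move=> H; apply: second_difference_mono_nonneg; first exact: average_even.
move=> s x y x0 xy.
have [->|a0] := eqVneq a 0.
  rewrite !average0//; apply: (admissible_second_difference H).
  by rewrite !ger0_norm// (le_trans x0).
pose b := - ((x + y) / a).
pose refl z := -1 * z + b.
pose P z := h (y + s + a * z) + h (y - s + a * z) + 2 * h (x + a * z).
pose N z := h (x + s + a * z) + h (x - s + a * z) + 2 * h (y + a * z).
have he := admissible_even H.
have PN z : P (refl z) = N z.
  rewrite /P /N (_ : y + s + a * refl z = - (x - s + a * z)); last first.
    by rewrite /refl /b; field.
  rewrite (_ : y - s + a * refl z = - (x + s + a * z)); last first.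
    by rewrite /refl /b; field.
  rewrite (_ : x + a * refl z = - (y + a * z)); last first.
    by rewrite /refl /b; field.
  by rewrite !he (addrC (h (x - s + _))).
have reflK z : refl (refl z) = z by rewrite /refl; ring.
have NP z : N (refl z) = P z by rewrite -PN reflK.
have three (u1 u2 u3 : R) : rintegrable (fun z => (h (u1 + a * z) + h (u2 + a * z)
      + 2 * h (u3 + a * z)) * w z) /\
    \int[mu]_z ((h (u1 + a * z) + h (u2 + a * z) + 2 * h (u3 + a * z)) * w z)
    = average w a h u1 + average w a h u2 + 2 * average w a h u3.
  have I u := average_integrable a u H.
  have I12 := rintegrableD (I u1) (I u2).
  have I3 := rintegrableZ 2 (I u3).
  rewrite (_ : (fun z => _ * w z) = (fun z => h (u1 + a * z) * w z +
     h (u2 + a * z) * w z + 2 * (h (u3 + a * z) * w z))); last first.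
    by apply/funext => z; ring.
  split; first exact: rintegrableD.
  rewrite (RintegralD measurableT I12 I3) (RintegralD measurableT (I u1) (I u2)).
  by rewrite (RintegralZl 2 measurableT (I u3)).
have [iP <-] := three (y + s) (y - s) x.
have [iN <-] := three (x + s) (x - s) y.
have m1 : (-1 : R) != 0 by rewrite oppr_eq0 oner_eq0.
have h0 := admissible_ge0 H.
have P0 z : 0 <= P z * w z.
  by rewrite mulr_ge0 ?(weight_ge0 W)// !addr_ge0// mulr_ge0.
have N0 z : 0 <= N z * w z.
  by rewrite mulr_ge0 ?(weight_ge0 W)// !addr_ge0// mulr_ge0.
have iPr := rintegrable_affine b m1 iP.
have iNr := rintegrable_affine b m1 iN.
have EP : \int[mu]_z (N z * w (refl z)) = \int[mu]_z (P z * w z).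
  have := @Rintegral_affine (-1) b _ m1 (rintegrable_measurable iP) P0.
  rewrite normrN1 invr1 mul1r => <-.
  by apply: eq_Rintegral => z _; rewrite -PN.
have EN : \int[mu]_z (P z * w (refl z)) = \int[mu]_z (N z * w z).
  have := @Rintegral_affine (-1) b _ m1 (rintegrable_measurable iN) N0.
  rewrite normrN1 invr1 mul1r => <-.
  by apply: eq_Rintegral => z _; rewrite -NP.
have iP' : rintegrable (fun z => P z * w (refl z)).
  by move: iNr; congr rintegrable; apply/funext => z; rewrite -NP.
have iN' : rintegrable (fun z => N z * w (refl z)).
  by move: iPr; congr rintegrable; apply/funext => z; rewrite -PN.
suff : \int[mu]_z (N z * w z + P z * w (refl z)) <=
       \int[mu]_z (P z * w z + N z * w (refl z)).
  rewrite (RintegralD measurableT iN iP') (RintegralD measurableT iP iN').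
  by rewrite EP EN -!mulr2n lerMn2r.
apply: le_Rintegral => //; [exact: rintegrableD|exact: rintegrableD|].
move=> z _; suff : 0 <= (P z - N z) * (w z - w (refl z)) by lra.
have reflE : a * (refl z + z) = - (x + y) by rewrite /refl /b; field.
have PNd := @admissible_second_difference _ _ H s (x + a * z) (y + a * z).
have NPd := @admissible_second_difference _ _ H s (y + a * z) (x + a * z).
have -> : P z = h (y + a * z + s) + h (y + a * z - s) + 2 * h (x + a * z).
  by rewrite /P; congr (h _ + h _ + _); ring.
have -> : N z = h (x + a * z + s) + h (x + a * z - s) + 2 * h (y + a * z).
  by rewrite /N; congr (h _ + h _ + _); ring.
have sqn (u v : R) : u ^+ 2 <= v ^+ 2 -> `|u| <= `|v|.
  by move=> uv; rewrite -(ler_pXn2r (n := 2)) ?nnegrE ?normr_ge0// !real_normK ?num_real.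
have az : a ^+ 2 * (refl z ^+ 2 - z ^+ 2) = (x + y) * (x + y + 2 * (a * z)).
  by rewrite /refl /b; field.
have a2 : 0 < a ^+ 2 by rewrite exprn_even_gt0.
have xy0 : 0 <= x + y by lra.
have [t0|t0] := leP 0 (x + y + 2 * (a * z)).
- apply: mulr_ge0; rewrite subr_ge0.
    by apply: PNd; apply: sqn; nra.
  apply: (weight_noninc W); apply: sqn.
  by rewrite -subr_ge0 -(pmulr_rge0 _ a2) az mulr_ge0.
- apply: mulr_le0; rewrite subr_le0.
    by apply: NPd; apply: sqn; nra.
  apply: (weight_noninc W); apply: sqn.
  by rewrite -subr_le0 -(pmulr_rle0 _ a2) az mulr_ge0_le0// ltW.
Qed.

Lemma average_admissible h a : admissible r h -> admissible r (average w a h).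
Proof.
move=> H; split.
- exact: average_even.
- exact: average_continuous.
- exact: average_ge0.
- exact: average_growth.
- exact: average_second_difference.
Qed.

End closure.
End averages.

(** * Merging two coordinates *)

Section two_variables.
Context {R : realType}.
Local Notation mu := (@lebesgue_measure R).
Local Notation RR := (measurableTypeR R * measurableTypeR R)%type.
Local Notation mu2 := (mu \x mu)%E.
Implicit Types (w v h f g : R -> R) (a b c r x y t : R) (z : RR).

Lemma measurable_affine2 f a b t : measurable_fun setT f ->
  measurable_fun setT (fun z : RR => f (t + a * z.1 + b * z.2)).
Proof.
move=> mf; apply: (measurableT_comp mf).
by apply: measurable_funD; [apply: measurable_funD => //|]; exact: measurable_funM.
Qed.

Lemma measurable_weight2 w v : weight w -> weight v ->
  measurable_fun setT (fun z : RR => w z.1 * v z.2).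
Proof.
move=> W V; apply: measurable_funM; apply: measurableT_comp => //.
  exact: weight_measurable W.
exact: weight_measurable V.
Qed.

Lemma int2_xy (F : RR -> R) : measurable_fun setT F -> (forall z, 0 <= F z) ->
  (\int[mu2]_z (F z)%:E = \int[mu]_x \int[mu]_y (F (x, y))%:E)%E.
Proof.
move=> mF F0; apply: (@fubini_tonelli1 _ _ _ _ _ mu mu (EFin \o F)).
  exact/measurable_EFinP.
by move=> z /=; rewrite lee_fin.
Qed.

Lemma int2_yx (F : RR -> R) : measurable_fun setT F -> (forall z, 0 <= F z) ->
  (\int[mu2]_z (F z)%:E = \int[mu]_y \int[mu]_x (F (x, y))%:E)%E.
Proof.
move=> mF F0; apply: (@fubini_tonelli2 _ _ _ _ _ mu mu (EFin \o F)).
  exact/measurable_EFinP.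
by move=> z /=; rewrite lee_fin.
Qed.

Section average_average.
Variables (w v : R -> R) (r : R) (h : R -> R).
Hypotheses (W : weight w) (V : weight v) (r0 : 0 <= r) (H : admissible r h).

Lemma average_averageE a b t :
  (\int[mu2]_z (h (t + a * z.1 + b * z.2)%R * (w z.1 * v z.2))%:E)%E =
  (average v b (average w a h) t)%:E.
Proof.
have h0 := admissible_ge0 H.
rewrite int2_yx; last 2 first.
- apply: measurable_funM; last exact: measurable_weight2.
  exact: measurable_affine2 (admissible_measurable H).
- by move=> z; rewrite !mulr_ge0 ?(weight_ge0 W) ?(weight_ge0 V).
rewrite EFin_Rintegral; last by apply: average_integrable; [exact: V|exact: r0|exact: average_admissible].
apply: eq_integral => y _; rewrite /=.
transitivity ((v y)%:E * (average w a h (t + b * y))%:E)%E; last first.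
  by rewrite -EFinM mulrC.
rewrite EFin_Rintegral; last exact: (average_integrable W r0).
rewrite -ge0_integralZl_EFin//; last 3 first.
- by move=> x _; rewrite lee_fin mulr_ge0 ?(weight_ge0 W).
- by apply/measurable_EFinP; exact: (rintegrable_measurable (average_integrable W r0 _ _ H)).
- exact: weight_ge0.
apply: eq_integral => x _; rewrite -EFinM; congr EFin.
by rewrite [t + _ + _]addrAC mulrA mulrC.
Qed.

End average_average.

Lemma average_comm w v r h a b t : weight w -> weight v -> 0 <= r -> admissible r h ->
  average v b (average w a h) t = average w a (average v b h) t.
Proof.
move=> W V r0 H; apply: EFin_inj.
rewrite -(average_averageE W V r0 H) -(average_averageE V W r0 H).
have h0 := admissible_ge0 H.
have mh := admissible_measurable H.
rewrite int2_yx ?int2_xy.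
- apply: eq_integral => y _; apply: eq_integral => x _ /=.
  by rewrite (mulrC (w x)) [t + _ + _]addrAC.
- by apply: measurable_funM; [exact: measurable_affine2|exact: measurable_weight2].
- by move=> z; rewrite !mulr_ge0 ?(weight_ge0 W) ?(weight_ge0 V).
- by apply: measurable_funM; [exact: measurable_affine2|exact: measurable_weight2].
- by move=> z; rewrite !mulr_ge0 ?(weight_ge0 W) ?(weight_ge0 V).
Qed.

Lemma average_opp w r h a : weight w -> 0 <= r -> admissible r h ->
  average w (- a) h = average w a h.
Proof.
move=> W r0 H; apply/funext => y; rewrite /average.
have m1 : (-1 : R) != 0 by rewrite oppr_eq0 oner_eq0.
have := @Rintegral_affine R (-1) 0 _ m1 (rintegrable_measurable (average_integrable W r0 a y H)).
rewrite normrN1 invr1 mul1r => <-.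
  apply: eq_Rintegral => x _; rewrite addr0 mulN1r (weight_even W).
  by congr (h _ * _); ring.
by move=> x; rewrite mulr_ge0 ?(weight_ge0 W) ?(admissible_ge0 H).
Qed.

Definition rotation_decreasing w := forall x y x' y',
  x ^+ 2 + y ^+ 2 = x' ^+ 2 + y' ^+ 2 ->
  Num.max `|x| `|y| <= Num.max `|x'| `|y'| -> w x' * w y' <= w x * w y.

Section pythagoras.
Variables (w : R -> R) (r : R) (h : R -> R) (a b c : R).
Hypotheses (W : weight w) (r0 : 0 <= r) (H : admissible r h).
Hypotheses (c0 : c != 0) (abc : c ^+ 2 = a ^+ 2 + b ^+ 2).

Let al := a / c.
Let be := b / c.
Let k x := h (c * x).
Let F0 (z : RR) := k z.1 + k z.2.
Let rho (z : RR) := w z.1 * w z.2.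
Let sigma (z : RR) : RR := (al * z.1 + be * z.2, be * z.1 - al * z.2).

Let albe : al ^+ 2 + be ^+ 2 = 1.
Proof. by rewrite !expr_div_n -mulrDl -abc divff// expf_eq0. Qed.

Let mk : measurable_fun setT k.
Proof.
apply: (measurableT_comp (admissible_measurable H)); exact: measurable_funM.
Qed.

Let mF0 : measurable_fun setT F0.
Proof. by apply: measurable_funD; apply: measurableT_comp. Qed.

Let mrho : measurable_fun setT rho.
Proof. exact: measurable_weight2. Qed.

Let msigma : measurable_fun setT sigma.
Proof.
apply: measurable_fun_pair.
  by apply: measurable_funD; exact: measurable_funM.
by apply: measurable_funB; exact: measurable_funM.
Qed.

Let k0 x : 0 <= k x. Proof. exact: admissible_ge0 H _. Qed.
Let F00 z : 0 <= F0 z. Proof. by rewrite addr_ge0. Qed.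
Let rho0 z : 0 <= rho z. Proof. by rewrite mulr_ge0 ?(weight_ge0 W). Qed.

Let sigmaK z : sigma (sigma z) = z.
Proof.
case: z => x y; rewrite /sigma /=; congr (_, _).
  by rewrite -[RHS]mul1r -albe; ring.
by rewrite -[RHS]mul1r -albe; ring.
Qed.

Let int2_sigma (F : RR -> R) : measurable_fun setT F -> (forall z, 0 <= F z) ->
  (\int[mu2]_z (F (sigma z))%:E = \int[mu2]_z (F z)%:E)%E.
Proof.
move=> mF Fge0.
have mE : measurable_fun setT (EFin \o F) by exact/measurable_EFinP.
rewrite [RHS]int2_xy//.
rewrite -(ge0_integral_reflection albe mE); last by move=> z; rewrite /= lee_fin.
rewrite int2_xy//; exact: measurableT_comp.
Qed.

Let int2D (F G : RR -> R) : measurable_fun setT F -> measurable_fun setT G ->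
  (forall z, 0 <= F z) -> (forall z, 0 <= G z) ->
  (\int[mu2]_z (F z + G z)%:E = \int[mu2]_z (F z)%:E + \int[mu2]_z (G z)%:E)%E.
Proof.
move=> mF mG Fge0 Gge0; under eq_integral do rewrite EFinD.
by rewrite ge0_integralD//; try (by move=> z _; rewrite lee_fin); exact/measurable_EFinP.
Qed.

Let mul_meas (F G : RR -> R) : measurable_fun setT F -> measurable_fun setT G ->
  measurable_fun setT (fun z => F z * G z).
Proof. exact: measurable_funM. Qed.

Let J0 : (\int[mu2]_z (F0 z * rho z)%:E)%E = (2 * average w c h 0)%:E.
Proof.
have E1 : (\int[mu2]_z (k z.1 * rho z)%:E)%E = (average w c h 0)%:E.
  rewrite -[in RHS](@average0 _ _ _ W _ 0 (average_admissible W r0 c H)).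
  rewrite -(average_averageE W W r0 H); apply: eq_integral => z _.
  by rewrite /k add0r mul0r addr0.
have E2 : (\int[mu2]_z (k z.2 * rho z)%:E)%E = (average w c h 0)%:E.
  have -> : average w c h 0 = average w c (average w 0 h) 0.
    by congr (average w c _ _); apply/funext => y; rewrite (average0 W _ H).
  rewrite -(average_averageE W W r0 H); apply: eq_integral => z _.
  by rewrite /k mul0r !add0r.
under eq_integral do rewrite mulrDl.
rewrite int2D//.
- by rewrite E1 E2 -EFinD; congr EFin; ring.
- by apply: mul_meas => //; apply: measurableT_comp.
- by apply: mul_meas => //; apply: measurableT_comp.
- by move=> z; rewrite mulr_ge0.
- by move=> z; rewrite mulr_ge0.
Qed.

Let J1 : (\int[mu2]_z (F0 (sigma z) * rho z)%:E)%E =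
  (2 * average w b (average w a h) 0)%:E.
Proof.
have aE : c * al = a by rewrite /al mulrCA divff ?mulr1.
have bE : c * be = b by rewrite /be mulrCA divff ?mulr1.
have E1 : (\int[mu2]_z (k (sigma z).1 * rho z)%:E)%E =
    (average w b (average w a h) 0)%:E.
  rewrite -(average_averageE W W r0 H); apply: eq_integral => z _.
  rewrite /k (_ : c * (sigma z).1 = 0 + a * z.1 + b * z.2)// -[in RHS]aE -[in RHS]bE /=.
  by ring.
have E2 : (\int[mu2]_z (k (sigma z).2 * rho z)%:E)%E =
    (average w b (average w a h) 0)%:E.
  rewrite (average_comm _ _ _ W W r0 H) -(average_opp a W r0); last first.
    exact: average_admissible.
  rewrite -(average_averageE W W r0 H); apply: eq_integral => z _.
  rewrite /k (_ : c * (sigma z).2 = 0 + b * z.1 + - a * z.2)// -[in RHS]aE -[in RHS]bE /=.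
  by ring.
under eq_integral do rewrite mulrDl.
rewrite int2D//.
- by rewrite E1 E2 -EFinD; congr EFin; ring.
- apply: mul_meas => //; apply: (measurableT_comp mk).
  by apply: measurableT_comp.
- apply: mul_meas => //; apply: (measurableT_comp mk).
  by apply: measurableT_comp.
- by move=> z; rewrite mulr_ge0.
- by move=> z; rewrite mulr_ge0.
Qed.

Let sigma_norm z : z.1 ^+ 2 + z.2 ^+ 2 = (sigma z).1 ^+ 2 + (sigma z).2 ^+ 2.
Proof. by case: z => x y /=; rewrite -[LHS]mul1r -albe; ring. Qed.

(** Normalize (a, b) to the unit vector (al, be): [sigma] is the reflection
    exchanging the directions (1, 0) and (al, be), and [F0] the sum of [k] over
    two orthogonal directions. As [rho] is invariant under quarter turns, the
    integral of [F0 * rho] is twice the left-hand side and that of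
    [(F0 \o sigma) * rho] twice the right-hand side. The product of
    [F0 \o sigma - F0] and [rho - rho \o sigma] is nonnegative pointwise, and
    [sigma] preserves the Lebesgue measure. *)
Lemma average_pythagoras_le : rotation_decreasing w ->
  average w c h 0 <= average w b (average w a h) 0.
Proof.
move=> rw.
have ek : even_fun k by move=> x; rewrite /k mulrN (admissible_even H).
have ck : square_convex k.
  have sh := second_difference_square_convex (admissible_even H)
    (admissible_continuous H) (admissible_second_difference H).
  exact: square_convex_scale (admissible_even H) sh.
have pt z : F0 z * rho z + F0 (sigma z) * rho (sigma z) <=
            F0 (sigma z) * rho z + F0 z * rho (sigma z).
  suff : 0 <= (F0 (sigma z) - F0 z) * (rho z - rho (sigma z)) by lra.
  have [m|/ltW m] := leP (Num.max `|z.1| `|z.2|) (Num.max `|(sigma z).1| `|(sigma z).2|).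
    apply: mulr_ge0; rewrite subr_ge0.
      exact: (square_convex_four_points ek ck (sigma_norm z)).
    exact: (rw _ _ _ _ (sigma_norm z)).
  apply: mulr_le0; rewrite subr_le0.
    exact: (square_convex_four_points ek ck (esym (sigma_norm z))).
  exact: (rw _ _ _ _ (esym (sigma_norm z))).
have mFs : measurable_fun setT (F0 \o sigma) by exact: measurableT_comp.
have mrs : measurable_fun setT (rho \o sigma) by exact: measurableT_comp.
have m1 := mul_meas mF0 mrho.
have m2 : measurable_fun setT (fun z => F0 (sigma z) * rho (sigma z)).
  exact: mul_meas mFs mrs.
have m3 : measurable_fun setT (fun z => F0 (sigma z) * rho z).
  exact: mul_meas mFs mrho.
have m4 : measurable_fun setT (fun z => F0 z * rho (sigma z)).
  exact: mul_meas mF0 mrs.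
have p1 z : 0 <= F0 z * rho z by rewrite mulr_ge0.
have p3 z : 0 <= F0 (sigma z) * rho z by rewrite mulr_ge0.
have p4 z : 0 <= F0 z * rho (sigma z) by rewrite mulr_ge0.
have I4 : (\int[mu2]_z (F0 z * rho (sigma z))%:E)%E =
    (2 * average w b (average w a h) 0)%:E.
  rewrite -J1 -(int2_sigma m3)//; apply: eq_integral => z _.
  by transitivity (F0 (sigma (sigma z)) * rho (sigma z))%:E; first by rewrite sigmaK.
have : (\int[mu2]_z (F0 z * rho z + F0 (sigma z) * rho (sigma z))%:E <=
        \int[mu2]_z (F0 (sigma z) * rho z + F0 z * rho (sigma z))%:E)%E.
  apply: ge0_le_integral => //.
  - by move=> z _; rewrite lee_fin addr_ge0.
  - by apply/measurable_EFinP; exact: measurable_funD.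
  - by apply/measurable_EFinP; exact: measurable_funD.
  - by move=> z _; rewrite lee_fin.
rewrite (int2D m1 m2)// (int2D m3 m4)// (int2_sigma m1)// J0 J1 I4.
by rewrite -!EFinD lee_fin; lra.
Qed.

(** If [rho] depends on x^2 + y^2 only, as for Gaussian densities, the two
    integrals are exchanged by the reflection. *)
Lemma average_pythagoras_eq : (forall x y x' y',
    x ^+ 2 + y ^+ 2 = x' ^+ 2 + y' ^+ 2 -> w x * w y = w x' * w y') ->
  average w b (average w a h) 0 = average w c h 0.
Proof.
move=> rw.
have : (2 * average w b (average w a h) 0)%:E = (2 * average w c h 0)%:E :> \bar R.
  rewrite -J0 -J1 -(int2_sigma (mul_meas mF0 mrho)); last first.
    by move=> z; rewrite mulr_ge0.
  apply: eq_integral => z _; congr (_ * _)%:E.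
  exact: (rw _ _ _ _ (sigma_norm z)).
by case=> E; apply: (@mulfI _ 2) => //; rewrite E.
Qed.

End pythagoras.
End two_variables.

(** * Comparison of two densities that cross twice *)

Section crossing.
Context {R : realType}.
Local Notation mu := (@lebesgue_measure R).
Implicit Types (w g h : R -> R) (a c d r x y z : R).

Lemma square_convex_chord h c d : square_convex h -> 0 <= c -> c < d ->
  exists A B, (forall x, c <= x -> x <= d -> h x <= A + B * x ^+ 2) /\
    (forall x, 0 <= x -> x <= c \/ d <= x -> A + B * x ^+ 2 <= h x).
Proof.
move=> hc c0 cd; have cd2 : 0 < d ^+ 2 - c ^+ 2 by nra.
pose B := (h d - h c) / (d ^+ 2 - c ^+ 2).
have BE : B * (d ^+ 2 - c ^+ 2) = h d - h c by rewrite mulfVK// gt_eqF.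
clearbody B; exists (h c - B * c ^+ 2), B.
have LE x : (d ^+ 2 - c ^+ 2) * (h c - B * c ^+ 2 + B * x ^+ 2) =
    (d ^+ 2 - x ^+ 2) * h c + (x ^+ 2 - c ^+ 2) * h d.
  have -> : h d = h c + B * (d ^+ 2 - c ^+ 2) by rewrite BE; ring.
  by ring.
split=> [x cx xd|x x0 [xc|dx]]; rewrite -(ler_pM2l cd2) LE.
- exact: hc.
- by have := hc x c d x0 xc (ltW cd); lra.
- by have := hc c d x c0 (ltW cd) dx; lra.
Qed.

Lemma weight_rintegrable w : weight w -> rintegrable w.
Proof.
move=> W; have := weight_moment W (lexx 0).
by under [X in rintegrable X]eq_fun do rewrite powRr0 mul1r.
Qed.

Lemma weight_square_rintegrable w : weight w -> rintegrable (fun x => x ^+ 2 * w x).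
Proof.
move=> W; have := weight_moment W (ler0n _ 2).
apply: ge0_rintegrable.
  apply: measurable_funM; [exact: exprn_measurable|exact: weight_measurable].
move=> x; rewrite mulr_ge0 ?sqr_ge0 ?(weight_ge0 W)//=.
rewrite ler_wpM2r ?(weight_ge0 W)// powR_mulrn ?addr_ge0//.
rewrite -(real_normK (num_real x)).
by have := normr_ge0 x; nra.
Qed.

(** Let c and d be the infimum and the supremum of the x >= 0 at which [w]
    exceeds [g], and A + B x^2 the function that agrees with h (a x) at c and d.
    Then (g - w) (h (a x) - A - B x^2) is nonnegative, while the integral of
    (g - w) (A + B x^2) vanishes. If [w] exceeds [g] at no more than one
    nonnegative point, the comparison is immediate almost everywhere. *)
Lemma average_le_crossing w g r h a : weight w -> weight g -> 0 <= r ->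
  admissible r h ->
  \int[mu]_x (x ^+ 2 * w x) = \int[mu]_x (x ^+ 2 * g x) ->
  (forall x y z, 0 <= x -> x <= y -> y <= z ->
     g x < w x -> g z < w z -> g y < w y) ->
  (exists M, forall x, M <= x -> w x <= g x) ->
  average w a h 0 <= average g a h 0.
Proof.
move=> W G r0 H mom2 J_convex [M J_bounded].
pose k x := h (a * x).
have k0 x : 0 <= k x by exact: admissible_ge0 H _.
have averageE v : average v a h 0 = \int[mu]_x (k x * v x).
  by apply: eq_Rintegral => x _; rewrite add0r.
have ki v : weight v -> rintegrable (fun x => k x * v x).
  move=> V; have := average_integrable V r0 a 0 H.
  by under [X in rintegrable X]eq_fun do rewrite add0r.
have ek : even_fun k by move=> x; rewrite /k mulrN (admissible_even H).
have kn x : k `|x| = k x by case: (ger0P x) => _ //; rewrite ek.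
have wn x : w `|x| = w x by case: (ger0P x) => _ //; rewrite (weight_even W).
have gn x : g `|x| = g x by case: (ger0P x) => _ //; rewrite (weight_even G).
pose J := [set x | 0 <= x /\ g x < w x].
rewrite !averageE.
have [[c [d [Jc Jd cd]]]|noJ] := pselect (exists c d, [/\ J c, J d & c < d]); last first.
  have kiw := ki _ W; have kig := ki _ G.
  rewrite -lee_fin !EFin_Rintegral//.
  apply: ae_ge0_le_integral => //.
  - by move=> x _; rewrite lee_fin mulr_ge0 ?(weight_ge0 W).
  - by apply/measurable_EFinP; exact: (rintegrable_measurable kiw).
  - by move=> x _; rewrite lee_fin mulr_ge0 ?(weight_ge0 G).
  - by apply/measurable_EFinP; exact: (rintegrable_measurable kig).
  have [[c Jc]|J0] := pselect (exists c, J c); last first.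
    apply: aeW => x _; rewrite lee_fin ler_wpM2l// -wn -gn leNgt; apply/negP => gw.
    by apply: J0; exists `|x|.
  have : mu.-negligible ([set c] `|` [set - c]).
    have n1 (u : R) : mu.-negligible [set u].
      by exists [set u]; split => //; exact: lebesgue_measure_set1.
    exact: negligibleU.
  apply: negligibleS => x /= /not_implyP[_ Nle].
  have Jx : J `|x|.
    split=> //; rewrite ltNge; apply/negP => wg; apply: Nle.
    by rewrite lee_fin ler_wpM2l// -wn -gn.
  have [xc|cx|<-] := ltgtP `|x| c.
  - by exfalso; apply: noJ; exists `|x|, c.
  - by exfalso; apply: noJ; exists c, `|x|.
  - by case: (ger0P x) => _; [left|right]; rewrite ?opprK.
have Jub : has_sup J.
  split; first by exists c.
  exists M => x [_ gwx]; rewrite leNgt; apply/negP => /ltW /J_bounded; lra.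
have Jlb : has_inf J by split; [exists c|exists 0 => x []].
pose c' := inf J; pose d' := sup J.
have c'J x : J x -> c' <= x by move=> Jx; apply: ge_inf => //; case: Jlb.
have d'J x : J x -> x <= d' by move=> Jx; apply: ub_le_sup => //; case: Jub.
have c'0 : 0 <= c' by apply: lb_le_inf; [exists c|move=> x []].
have cd' : c' < d' by apply: (le_lt_trans (c'J _ Jc)); apply: (lt_le_trans cd); exact: d'J.
have outJ x : 0 <= x -> ~ J x -> x <= c' \/ d' <= x.
  move=> x0 NJx; have [xc|cx] := leP x c'; first by left.
  have [dx|xd] := leP d' x; first by right.
  have [y [y0 Jy] yx] := inf_lt (proj1 Jlb) cx.
  have [z [z0 Jz] xz] := sup_gt (proj1 Jub) xd.
  by exfalso; apply: NJx; split=> //; apply: (J_convex y x z) => //; exact: ltW.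
have ck : square_convex k.
  have sh := second_difference_square_convex (admissible_even H)
    (admissible_continuous H) (admissible_second_difference H).
  exact: square_convex_scale (admissible_even H) sh.
have [A [B [inside outside]]] := square_convex_chord ck c'0 cd'.
have pt x : k x * w x + (A * (g x - w x) + B * (x ^+ 2 * g x - x ^+ 2 * w x)) <= k x * g x.
  suff : 0 <= (g x - w x) * (k x - (A + B * x ^+ 2)) by lra.
  rewrite -(kn x) -(wn x) -(gn x) -(real_normK (num_real x)).
  have [Jx|NJx] := pselect (J `|x|).
    apply: mulr_le0; rewrite subr_le0; first by case: Jx => _ /ltW.
    by apply: inside; [exact: c'J|exact: d'J].
  apply: mulr_ge0; rewrite subr_ge0.
    by rewrite leNgt; apply/negP => gw; apply: NJx.
  by apply: outside => //; exact: outJ.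
have iw := weight_rintegrable W; have ig := weight_rintegrable G.
have iw2 := weight_square_rintegrable W; have ig2 := weight_square_rintegrable G.
have i0 := rintegrableB ig iw; have i2 := rintegrableB ig2 iw2.
have i0A := rintegrableZ A i0; have i2B := rintegrableZ B i2.
have i02 := rintegrableD i0A i2B.
have := le_Rintegral measurableT (rintegrableD (ki _ W) i02) (ki _ G) (fun x _ => pt x).
rewrite (RintegralD measurableT (ki _ W) i02) (RintegralD measurableT i0A i2B).
rewrite (RintegralZl A measurableT i0) (RintegralZl B measurableT i2).
rewrite (RintegralB measurableT ig iw) (RintegralB measurableT ig2 iw2).
by rewrite (weight_mass W) (weight_mass G) mom2 !subrr !mulr0 !addr0.
Qed.

End crossing.

(** * Linear forms in independent coordinates *)

Section euclidean_space.
Context {R : realType}.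
Local Notation mu := (@lebesgue_measure R).

Lemma ge0_integral_Rn_cons n (F : Rn R n.+1 -> \bar R) :
  measurable_fun setT F -> (forall x, (0 <= F x)%E) ->
  (\int[lebesgue_measure_Rn n.+1]_x F x =
   \int[lebesgue_measure_Rn n]_t \int[mu]_z F (Rn_cons (z, t)))%E.
Proof.
move=> mF F0.
have mc := @measurable_Rn_cons R n.
rewrite (eq_measure_integral (pushforward (mu \x lebesgue_measure_Rn n)%E (@Rn_cons R n)))//.
rewrite ge0_integral_pushforward// preimage_setT.
rewrite (@fubini_tonelli2 _ _ _ _ _ mu (lebesgue_measure_Rn n) (F \o @Rn_cons R n))//.
- exact: measurableT_comp.
- by move=> z; exact: F0.
Qed.

Lemma ge0_integral_Rn0 (F : Rn R 0 -> \bar R) : measurable_fun setT F ->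
  (forall x, (0 <= F x)%E) ->
  (\int[lebesgue_measure_Rn 0]_x F x = F [tuple])%E.
Proof.
by move=> mF F0; rewrite /= integral_dirac// diracT mul1e.
Qed.

Definition product_density (w : R -> R) n (x : Rn R n) := \prod_(i < n) w (tnth x i).
Definition linear_form n (a : 'I_n -> R) (x : Rn R n) := \sum_(i < n) a i * tnth x i.

Lemma measurable_linear_form n (a : 'I_n -> R) : measurable_fun setT (linear_form a).
Proof.
apply: measurable_sum => i; apply: measurable_funM => //; exact: measurable_tnth.
Qed.

Lemma measurable_product_density w n : measurable_fun setT w ->
  measurable_fun setT (@product_density w n).
Proof.
move=> mw; apply: measurable_prod => i _.
apply: (measurableT_comp mw); exact: measurable_tnth.
Qed.

Lemma linear_form_cons n (a : 'I_n.+1 -> R) z t :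
  linear_form a (Rn_cons (z, t)) = a ord0 * z + linear_form (a \o lift ord0) t.
Proof.
rewrite /linear_form big_ord_recl; congr (_ + _).
by apply: eq_bigr => i _; rewrite tnthS.
Qed.

Lemma product_density_cons w n z (t : Rn R n) :
  product_density w (Rn_cons (z, t)) = w z * product_density w t.
Proof.
rewrite /product_density big_ord_recl; congr (_ * _).
by apply: eq_bigr => i _; rewrite tnthS.
Qed.

Definition euclidean_norm n (a : 'I_n -> R) := Num.sqrt (\sum_(i < n) a i ^+ 2).

Lemma euclidean_norm_cons n (a : 'I_n.+1 -> R) :
  euclidean_norm a ^+ 2 = a ord0 ^+ 2 + euclidean_norm (a \o lift ord0) ^+ 2.
Proof.
have s0 m (b : 'I_m -> R) : 0 <= \sum_(i < m) b i ^+ 2.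
  by apply: sumr_ge0 => i _; exact: sqr_ge0.
by rewrite /euclidean_norm !sqr_sqrtr// big_ord_recl.
Qed.

Section product_means.
Variables (w : R -> R) (r : R).
Hypotheses (W : weight w) (r0 : 0 <= r).

Definition product_mean n (h : R -> R) (a : 'I_n -> R) : \bar R :=
  (\int[lebesgue_measure_Rn n]_x (h (linear_form a x) * product_density w x)%:E)%E.

Let measurable_integrand n (h : R -> R) (a : 'I_n -> R) : measurable_fun setT h ->
  measurable_fun setT (fun x => (h (linear_form a x) * product_density w x)%:E).
Proof.
move=> mh; apply/measurable_EFinP; apply: measurable_funM.
  by apply: (measurableT_comp mh); exact: measurable_linear_form.
exact: (measurable_product_density (weight_measurable W)).
Qed.

Let product_density_ge0 n (x : Rn R n) : 0 <= product_density w x.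
Proof. by apply: prodr_ge0 => i _; exact: weight_ge0 W _. Qed.

(** Integrating out the first coordinate turns [h] into its average. *)
Lemma product_meanS n h (a : 'I_n.+1 -> R) : admissible r h ->
  product_mean h a = product_mean (average w (a ord0) h) (a \o lift ord0).
Proof.
move=> H; have h0 := admissible_ge0 H; have mh := admissible_measurable H.
rewrite /product_mean ge0_integral_Rn_cons//; last 2 first.
- exact: measurable_integrand.
- by move=> x; rewrite lee_fin mulr_ge0.
apply: eq_integral => t _.
set y := linear_form _ t.
transitivity ((product_density w t)%:E * (average w (a ord0) h y)%:E)%E; last first.
  by rewrite -EFinM mulrC.
rewrite (EFin_Rintegral (average_integrable W r0 (a ord0) y H)).
rewrite -ge0_integralZl_EFin//; last 2 first.
- by move=> x _; rewrite lee_fin mulr_ge0 ?(weight_ge0 W).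
- apply/measurable_EFinP; exact: (rintegrable_measurable (average_integrable W r0 _ _ H)).
apply: eq_integral => z _; rewrite linear_form_cons product_density_cons -EFinM.
by rewrite -/y [a ord0 * z + _]addrC; congr EFin; ring.
Qed.

Lemma product_mean0 h (a : 'I_0 -> R) : admissible r h -> product_mean h a = (h 0)%:E.
Proof.
move=> H; have h0 := admissible_ge0 H; have mh := admissible_measurable H.
rewrite /product_mean ge0_integral_Rn0//; last 2 first.
- exact: measurable_integrand.
- by move=> x; rewrite lee_fin mulr_ge0.
by rewrite /linear_form /product_density !big_ord0 mulr1.
Qed.

Lemma product_mean_const0 n h : admissible r h ->
  product_mean h (fun _ : 'I_n => 0) = (h 0)%:E.
Proof.
elim: n h => [|n IH] h H; first exact: product_mean0.
rewrite (product_meanS _ H) (_ : _ \o _ = fun=> 0)//.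
by rewrite (IH _ (average_admissible W r0 0 H)) (average0 W _ H).
Qed.

Lemma product_mean_coordinate n h : admissible r h ->
  product_mean h (fun i : 'I_n.+1 => (i == ord0)%:R) = (average w 1 h 0)%:E.
Proof.
move=> H; rewrite product_meanS// eqxx.
rewrite (_ : _ \o _ = fun=> 0)//.
by rewrite (product_mean_const0 _ (average_admissible W r0 _ H)).
Qed.

(** By induction the coordinates other than the first merge into one of
    coefficient [euclidean_norm (a \o lift ord0)]; merge it with the first. *)
Lemma product_mean_ge n h (a : 'I_n -> R) : rotation_decreasing w -> admissible r h ->
  ((average w (euclidean_norm a) h 0)%:E <= product_mean h a)%E.
Proof.
move=> rw; elim: n h a => [|n IH] h a H.
  by rewrite (product_mean0 _ H) /euclidean_norm big_ord0 sqrtr0 (average0 W _ H).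
rewrite (product_meanS _ H); have H' := average_admissible W r0 (a ord0) H.
apply: le_trans (IH _ _ H'); rewrite lee_fin.
have [n0|n0] := eqVneq (euclidean_norm a) 0.
  have := euclidean_norm_cons a; rewrite n0 expr0n/= => /esym/eqP.
  rewrite paddr_eq0 ?sqr_ge0// !sqrf_eq0 => /andP[/eqP -> /eqP ->].
  by rewrite (average0 W _ (average_admissible W r0 0 H)).
by apply: (average_pythagoras_le W r0 H n0) => //; exact: euclidean_norm_cons.
Qed.

(** By induction the coordinates other than the first are replaced by one
    Gaussian variable; exchange the two averages, replace the first coordinate
    too, and use the rotation invariance of the Gaussian density. *)
Lemma product_mean_le (g : R -> R) n h (a : 'I_n -> R) : weight g ->
  (forall x y x' y', x ^+ 2 + y ^+ 2 = x' ^+ 2 + y' ^+ 2 ->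
    g x * g y = g x' * g y') ->
  (forall c h, admissible r h -> average w c h 0 <= average g c h 0) ->
  admissible r h ->
  (product_mean h a <= (average g (euclidean_norm a) h 0)%:E)%E.
Proof.
move=> G rg wg; elim: n h a => [|n IH] h a H.
  by rewrite (product_mean0 _ H) /euclidean_norm big_ord0 sqrtr0 (average0 G _ H).
rewrite (product_meanS _ H); have H' := average_admissible W r0 (a ord0) H.
apply: le_trans (IH _ _ H') _; rewrite lee_fin.
rewrite (average_comm _ _ _ W G r0 H).
apply: le_trans (wg _ _ (average_admissible G r0 _ H)) _.
rewrite (average_comm _ _ _ G G r0 H).
have [n0|n0] := eqVneq (euclidean_norm a) 0.
  have := euclidean_norm_cons a; rewrite n0 expr0n/= => /esym/eqP.
  rewrite paddr_eq0 ?sqr_ge0// !sqrf_eq0 => /andP[/eqP -> /eqP ->].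
  by rewrite (average0 G _ (average_admissible G r0 0 H)).
by rewrite (average_pythagoras_eq G r0 H n0) => //; exact: euclidean_norm_cons.
Qed.

End product_means.
End euclidean_space.

(** * Layer-cake formula and the Gamma function *)

Section gamma.
Context {R : realType}.
Local Notation mu := (@lebesgue_measure R).
Implicit Types (a p t y : R).

Lemma ge0_integralZl_real d (T : measurableType d) (m : {measure set T -> \bar R})
    (k : R) (g : T -> R) :
  0 <= k -> measurable_fun setT g -> (forall x, 0 <= g x) ->
  (\int[m]_x (k * g x)%:E = k%:E * \int[m]_x (g x)%:E)%E.
Proof.
move=> k0 mg g0; rewrite -ge0_integralZl_EFin//.
  by move=> x _; rewrite lee_fin.
exact/measurable_EFinP.
Qed.

Lemma measurable_expRN : measurable_fun setT (fun t : R => expR (- t)).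
Proof. by apply: measurableT_comp => //; exact: measurableT_comp. Qed.

Lemma measurable_ind_le d (T : measurableType d) (u v : T -> R) :
  measurable_fun setT u -> measurable_fun setT v ->
  measurable_fun setT (fun z => (u z <= v z)%R%:R : R).
Proof.
move=> mu mv.
have mS : measurable [set z | u z <= v z].
  rewrite -[X in measurable X]setTI.
  have := measurable_fun_ler mu mv measurableT (Y := [set true]).
  by apply.
have mI : measurable_fun setT (\1_[set z | u z <= v z] : T -> R).
  exact: measurable_indic.
move: mI; congr measurable_fun; apply/funext => z.
by rewrite indicE; congr (_%:R); rewrite mem_setE.
Qed.

Lemma measurable_ind_lt d (T : measurableType d) (u v : T -> R) :
  measurable_fun setT u -> measurable_fun setT v ->
  measurable_fun setT (fun z => (u z < v z)%R%:R : R).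
Proof.
move=> mu mv; have mB := measurable_funB (@measurable_cst _ _ T _ setT (1 : R)) (measurable_ind_le mv mu).
move: mB; congr measurable_fun; apply/funext => z; by rewrite /= ltNge; case: (_ <= _); rewrite ?subrr ?subr0.
Qed.

Lemma integral_expR_tail a :
  (\int[mu]_t ((a <= t)%R%:R * expR (- t))%:E = (expR (- a))%:E)%E.
Proof.
have mf : measurable_fun setT (fun t : R => ((a <= t)%R%:R * expR (- t))%:E).
  apply/measurable_EFinP; apply: measurable_funM; first exact: measurable_ind_le.
  by apply: measurableT_comp => //; exact: measurableT_comp.
have := @ge0_integral_affine R 1 a _ (oner_neq0 _) mf.
rewrite normr1 invr1 mul1e => <-; last by move=> t; rewrite lee_fin mulr_ge0.
transitivity ((expR (- a))%:E * \int[mu]_t (exponential_pdf 1 t)%:E)%E.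
  rewrite -(ge0_integralZl_real mu (expR_ge0 _) (measurable_exponential_pdf 1)
    (exponential_pdf_ge0 ler01)).
  apply: eq_integral => t _; rewrite mul1r lerDr; congr EFin.
  have [t0|t0] := leP 0 t.
    by rewrite exponential_pdfE// mulN1r !mul1r opprD expRD mulrC.
  by rewrite lt0_exponential_pdf// mulr0 mul0r.
by rewrite integral_exponential_pdf// mule1.
Qed.

(** This is Gamma (y + 1), as an extended real. *)
Definition gamma_integral y : \bar R :=
  (\int[mu]_t ((0 < t)%R%:R * t `^ y * expR (- t))%:E)%E.

Lemma measurable_powRl y : measurable_fun setT (fun t : R => t `^ y).
Proof. exact: measurable_powR. Qed.

Lemma measurable_gamma_integrand y :
  measurable_fun setT (fun t : R => ((0 < t)%R%:R * t `^ y * expR (- t))%:E).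
Proof.
apply/measurable_EFinP; apply: measurable_funM.
  by apply: measurable_funM; [exact: measurable_ind_lt|exact: measurable_powRl].
by apply: measurableT_comp => //; exact: measurableT_comp.
Qed.

Lemma gamma_integrand_ge0 y t : (0 <= ((0 < t)%R%:R * t `^ y * expR (- t))%:E)%E.
Proof. by rewrite lee_fin !mulr_ge0 ?powR_ge0 ?expR_ge0. Qed.

Lemma Gamma_gamma_integral (z : R) : Gamma z = fine (gamma_integral (z - 1)).
Proof.
rewrite /Gamma /gamma_integral /Rintegral; congr fine.
rewrite integral_mkcond; apply: eq_integral => t _.
rewrite patchE mem_setE in_itv/= andbT.
by case: (0 < t); rewrite ?mul1r// !mul0r.
Qed.

(** Write exp(-N x) as the integral of exp(-t) over t >= N x and exchange the
    integrals. *)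
Lemma layer_cake_expR d (T : measurableType d)
    (m : {sigma_finite_measure set T -> \bar R}) (f N : T -> R) (C : \bar R) y :
  measurable_fun setT f -> (forall x, 0 <= f x) ->
  measurable_fun setT N -> (forall x, 0 <= N x) -> (0 <= C)%E ->
  (forall t, 0 < t ->
    (\int[m]_x (f x * (N x <= t)%R%:R)%:E = (t `^ y)%:E * C)%E) ->
  (\int[m]_x (f x * expR (- N x))%:E = C * gamma_integral y)%E.
Proof.
move=> mf f0 mN N0 C0 fN.
pose K (z : T * measurableTypeR R) : R :=
  f z.1 * (N z.1 <= z.2)%R%:R * expR (- z.2).
have mK : measurable_fun setT K.
  apply: measurable_funM; last first.
    by apply: measurableT_comp => //; exact: measurableT_comp.
  apply: measurable_funM; first exact: measurableT_comp.
  by apply: measurable_ind_le => //; exact: measurableT_comp.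
have K0 z : 0 <= K z by rewrite !mulr_ge0 ?expR_ge0.
have mKe : measurable_fun setT (EFin \o K) by exact/measurable_EFinP.
have K0e z : (0 <= (EFin \o K) z)%E by rewrite lee_fin.
have /= fub := @fubini_tonelli _ _ _ _ _ m mu (EFin \o K) mKe K0e.
transitivity (\int[m]_x \int[mu]_t (K (x, t))%:E)%E.
  apply: eq_integral => x _.
  transitivity ((f x)%:E * \int[mu]_t ((N x <= t)%R%:R * expR (- t))%:E)%E.
    by rewrite integral_expR_tail.
  rewrite -(ge0_integralZl_real _ (f0 x)).
  - by apply: eq_integral => t _; rewrite mulrA.
  - apply: measurable_funM; first exact: measurable_ind_le.
    exact: measurable_expRN.
  - by move=> t; rewrite mulr_ge0 ?expR_ge0.
rewrite fub /gamma_integral -ge0_integralZl//; last 2 first.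
- exact: measurable_gamma_integrand.
- by move=> t _; exact: gamma_integrand_ge0.
apply: ae_eq_integral => //.
- exact: (@measurable_fun_fubini_tonelli_G _ _ _ _ _ m (EFin \o K) mKe K0e).
- by apply: emeasurable_funM => //; exact: measurable_gamma_integrand.
(* t = 0 is left out: the zero set of N need not be null for m *)
have : mu.-negligible [set (0 : R)].
  by exists [set 0]; split => //; exact: lebesgue_measure_set1.
apply: negligibleS => t /= /not_implyP[_ ne].
have [t0|t0|//] := ltgtP t 0; exfalso; apply: ne.
  rewrite ltNge (ltW t0)/= !mul0r mule0 integral0_eq// => x _.
  by rewrite /K/= leNgt (lt_le_trans t0 (N0 x))/= mulr0 mul0r.
transitivity ((expR (- t))%:E * \int[m]_x (f x * (N x <= t)%R%:R)%:E)%E.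
  rewrite -(ge0_integralZl_real _ (expR_ge0 _)).
  - by apply: eq_integral => x _; rewrite mulrC.
  - by apply: measurable_funM => //; exact: measurable_ind_le.
  - by move=> x; rewrite mulr_ge0.
by rewrite fN// t0 mul1r EFinM muleCA [in RHS]muleCA (muleC C).
Qed.

Lemma continuous_abs_pow0 p : 0 <= p -> continuous (@abs_pow R p).
Proof.
rewrite le_eqVlt => /predU1P[<-|]; last exact: continuous_abs_pow.
rewrite (_ : abs_pow 0 = cst 1); first by move=> x; exact: cvg_cst.
by apply/funext => x; rewrite /abs_pow powRr0.
Qed.

Lemma integral_powR_itv y a : 0 <= y -> 0 < a ->
  (\int[mu]_s ((0 < s)%R%:R * (s <= a)%R%:R * s `^ y)%:E = (a `^ (y + 1) / (y + 1))%:E)%E.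
Proof.
move=> y0 a0; have y1 : 0 < y + 1 by lra.
transitivity (\int[mu]_(s in `[0%R, a]) (abs_pow y s)%:E)%E.
  rewrite -integral_itv_obnd_cbnd; last first.
    apply/measurable_EFinP; apply: measurable_funTS.
    by apply: continuous_measurable_fun; exact: continuous_abs_pow0.
  rewrite [RHS]integral_mkcond; apply: eq_integral => s _.
  rewrite patchE mem_setE in_itv/= /abs_pow.
  have [s0|s0] := ltP 0 s; rewrite /= ?mul0r// gtr0_norm//.
  by case: (s <= a); rewrite ?mul0r ?mul1r ?mulr0 ?mul0r.
pose F s := (y + 1)^-1 * abs_pow (y + 1) s.
have cF : continuous F.
  by move=> s; apply: cvgM; [exact: cvg_cst|exact: continuous_abs_pow].
have dF (c : R) : 0 < c -> is_derive c 1 F (abs_pow y c).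
  move=> c0; have -> : abs_pow y c = (y + 1)^-1 *: ((y + 1) * (Num.sg c * `|c| `^ (y + 1 - 1))).
    by rewrite addrK gtr0_sg// mul1r /abs_pow /GRing.scale/= mulKf// gt_eqF.
  by apply: is_deriveZ; apply: is_derive_abs_pow; rewrite gt_eqF.
rewrite (@continuous_FTC2 R (abs_pow y) F 0 a a0).
- rewrite /F /abs_pow normr0 powR0 ?gt_eqF// mulr0 gtr0_norm// -EFinB subr0.
  by rewrite mulrC.
- by apply: continuous_subspaceT; exact: continuous_abs_pow0.
- split.
  + by move=> c; rewrite in_itv/= => /andP[c0 _]; have D := dF _ c0; exact: ex_derive.
  + exact/cvg_at_right_filter/cF.
  + exact/cvg_at_left_filter/cF.
- move=> c; rewrite in_itv/= => /andP[c0 _]; rewrite derive1E.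
  by have D := dF _ c0; exact: derive_val.
Qed.

(** The layer-cake formula for f s = z s^(z-1) on s > 0 and N s = |s|. *)
Lemma gamma_integralS (z : R) : 1 <= z -> gamma_integral z = (z%:E * gamma_integral (z - 1))%E.
Proof.
move=> z1; have z0 : 0 < z by lra.
have := @layer_cake_expR _ _ mu (fun s => (0 < s)%R%:R * (z * s `^ (z - 1))) (fun s => `|s|) 1%E z.
rewrite mul1e => <-//.
- rewrite -(ge0_integralZl_real _ (ltW z0)); last 2 first.
  + by apply/measurable_EFinP; exact: measurable_gamma_integrand.
  + by move=> t; rewrite !mulr_ge0 ?powR_ge0 ?expR_ge0.
  apply: eq_integral => s _; congr EFin.
  by case: (ltP 0 s) => s0; [rewrite gtr0_norm//; ring|rewrite !mul0r mulr0].
- apply: measurable_funM; first exact: measurable_ind_lt.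
  by apply: measurable_funM => //; exact: measurable_powRl.
- by move=> x; rewrite !mulr_ge0 ?powR_ge0 ?(ltW z0).
- exact: normr_measurable.
- move=> t t0; rewrite mule1.
  have z10 : 0 <= z - 1 by lra.
  transitivity (z%:E * (t `^ z / z)%:E)%E; last first.
    by rewrite -EFinM mulrC divfK// gt_eqF.
  have := integral_powR_itv z10 t0; rewrite subrK => <-.
  rewrite -(ge0_integralZl_real _ (ltW z0)); last 2 first.
  + apply: measurable_funM; last exact: measurable_powRl.
    by apply: measurable_funM; [exact: measurable_ind_lt|exact: measurable_ind_le].
  + by move=> s; rewrite !mulr_ge0 ?powR_ge0.
  apply: eq_integral => s _; congr EFin.
  by case: (ltP 0 s) => s0; [rewrite gtr0_norm//; ring|rewrite !mul0r mulr0].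
Qed.

(** The layer-cake formula for N x = x^2, followed by [gamma_integralS]. *)
Lemma integral_powR_gauss p : 1 <= p ->
  (\int[mu]_x (`|x| `^ p * expR (- x ^+ 2))%:E = gamma_integral ((p + 1) / 2 - 1))%E.
Proof.
move=> p1; have p0 : 0 < p by lra.
have p1' : 0 < p + 1 by lra.
have e0 : 0 <= 2 / (p + 1) by rewrite divr_ge0// ltW.
rewrite (@layer_cake_expR _ _ mu (fun x => `|x| `^ p) (fun x => x ^+ 2)
   (2 / (p + 1))%:E ((p + 1) / 2))//.
- rewrite gamma_integralS; last by rewrite ler_pdivlMr//; lra.
  rewrite muleA -EFinM (_ : 2 / (p + 1) * ((p + 1) / 2) = 1) ?mul1e//.
  by field; rewrite gt_eqF.
- by apply: (measurableT_comp (measurable_powRl p)).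
- by move=> x; exact: sqr_ge0.
move=> t t0; set a := Num.sqrt t.
have a0 : 0 < a by rewrite sqrtr_gt0.
have aE : t `^ ((p + 1) / 2) = a `^ (p + 1).
  by rewrite /a -powR12_sqrt ?(ltW t0)// -powRrM mulrC.
pose phi (s : R) : R := (0 < s)%R%:R * (s <= a)%R%:R * s `^ p.
have phi0 s : 0 <= phi s by rewrite !mulr_ge0 ?powR_ge0.
have mphi : measurable_fun setT phi.
  apply: measurable_funM; last exact: measurable_powRl.
  by apply: measurable_funM; [exact: measurable_ind_lt|exact: measurable_ind_le].
have mphiN : measurable_fun setT (fun s : R => phi (-1 * s + 0)).
  by apply: (measurableT_comp mphi); apply: measurable_funD => //; exact: measurable_funM.
have Iphi := integral_powR_itv (ltW p0) a0.
transitivity (\int[mu]_x ((phi x)%:E + (phi (-1 * x + 0))%:E))%E.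
  apply: eq_integral => x _; rewrite -EFinD; congr EFin.
  have xa : (x ^+ 2 <= t) = (`|x| <= a).
    have -> : t = a ^+ 2 by rewrite sqr_sqrtr ?(ltW t0).
    by rewrite -(real_normK (num_real x)) ler_pXn2r ?nnegrE ?(ltW a0).
  rewrite xa /phi addr0 mulN1r oppr_gt0.
  have [x0|x0|->] := ltgtP x 0.
  - by rewrite ltr0_norm// !mul0r add0r mul1r mulrC.
  - by rewrite gtr0_norm// !mul0r addr0 mul1r mulrC.
  - by rewrite normr0 powR0 ?gt_eqF// !mul0r addr0.
have e1 : measurable_fun setT (EFin \o phi) by exact/measurable_EFinP.
have e2 : measurable_fun setT (fun s : R => (phi (-1 * s + 0))%:E).
  exact/measurable_EFinP.
have q1 (s : R) : [set: R] s -> (0 <= (phi s)%:E)%E by rewrite lee_fin.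
have q2 (s : R) : [set: R] s -> (0 <= (phi (-1 * s + 0))%:E)%E by rewrite lee_fin.
rewrite (ge0_integralD mu measurableT q1 e1 q2 e2).
have m1 : (-1 : R) != 0 by rewrite oppr_eq0 oner_eq0.
have q3 (s : R) : (0 <= (EFin \o phi) s)%E by rewrite lee_fin.
rewrite (@ge0_integral_affine R (-1) 0 (EFin \o phi) m1 e1 q3) /=.
rewrite normrN1 invr1 mul1e Iphi aE -EFinD -EFinM; congr EFin.
by field; rewrite gt_eqF.
Qed.

End gamma.

(** * Polar integration in the norm of l_q *)

Section polar.
Context {R : realType}.
Local Notation mu := (@lebesgue_measure R).

Definition Rn_scale n (s : R) (x : Rn R n) : Rn R n := [tuple s * tnth x i | i < n].

Lemma measurable_Rn_scale n s : measurable_fun setT (@Rn_scale n s).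
Proof.
apply/measurable_fun_tnthP => i.
rewrite (_ : _ \o _ = fun x => s * tnth x i); last first.
  by apply/funext => x /=; rewrite tnth_mktuple.
by apply: measurable_funM => //; exact: measurable_tnth.
Qed.

Lemma Rn_scale_cons n s z (t : Rn R n) :
  Rn_scale s (Rn_cons (z, t)) = Rn_cons (s * z, Rn_scale s t).
Proof.
apply: eq_from_tnth => i; rewrite tnth_mktuple.
by case: (unliftP ord0 i) => [j ->|->]; rewrite ?tnthS ?tnth_mktuple// !(tnth_nth 0).
Qed.

Lemma ge0_integral_Rn_scale n s (F : Rn R n -> \bar R) : 0 < s ->
  measurable_fun setT F -> (forall x, (0 <= F x)%E) ->
  (\int[lebesgue_measure_Rn n]_x F x =
   (s ^+ n)%:E * \int[lebesgue_measure_Rn n]_x F (Rn_scale s x))%E.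
Proof.
move=> s0; elim: n F => [|n IH] F mF F0.
  rewrite expr0 mul1e; apply: eq_integral => x _; congr F.
  by apply: eq_from_tnth => -[].
have mFs : measurable_fun setT (F \o @Rn_scale n.+1 s).
  by apply: measurableT_comp => //; exact: measurable_Rn_scale.
rewrite (ge0_integral_Rn_cons mF F0).
rewrite (ge0_integral_Rn_cons mFs (fun x => F0 _)).
pose G (z : measurableTypeR R * Rn R n) := F (Rn_cons z).
have mG : measurable_fun setT G by apply: measurableT_comp => //; exact: measurable_Rn_cons.
have G0 z : (0 <= G z)%E by exact: F0.
pose G' (z : measurableTypeR R * Rn R n) := G (z.1, Rn_scale s z.2).
have mG' : measurable_fun setT G'.
  apply: measurableT_comp => //; apply: measurable_fun_pair => //.
  by apply: measurableT_comp => //; exact: measurable_Rn_scale.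
have mI := @measurable_fun_fubini_tonelli_G _ _ _ _ _ mu G mG G0.
rewrite (IH _ mI); last by move=> t; apply: integral_ge0 => z _; exact: G0.
rewrite exprSr EFinM -muleA; congr (_ * _)%E.
have mI' := @measurable_fun_fubini_tonelli_G _ _ _ _ _ mu G' mG' (fun z => G0 _).
have mGs : measurable_fun setT (fun z : measurableTypeR R * Rn R n => G' (s * z.1, z.2)).
  apply: (measurableT_comp mG'); apply: measurable_fun_pair => //.
  by apply: measurable_funM => //; exact: measurable_fst.
rewrite -ge0_integralZl_EFin ?(ltW s0)//; last 2 first.
- by move=> t _; apply: integral_ge0 => z _; exact: F0.
- have := @measurable_fun_fubini_tonelli_G _ _ _ _ _ mu _ mGs (fun z => G0 _).
  congr measurable_fun; apply/funext => t; apply: eq_integral => z _.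
  by rewrite /G' /G /= Rn_scale_cons.
apply: eq_integral => t _.
have mGt : measurable_fun setT (fun z : measurableTypeR R => G (z, Rn_scale s t)).
  exact: (measurable_fun_pair1 _ mG).
have := @ge0_integral_affine R s 0 _ (lt0r_neq0 s0) mGt (fun z => G0 _).
rewrite gtr0_norm// => E.
transitivity (s%:E * \int[mu]_z G ((s * z + 0)%R, Rn_scale s t))%E; last first.
  by congr (_ * _)%E; apply: eq_integral => z _; rewrite addr0 /= Rn_scale_cons.
by rewrite E muleA -EFinM divff ?gt_eqF// mul1e.
Qed.

Definition power_sum n (r : R) (x : Rn R n) := \sum_(i < n) `|tnth x i| `^ r.

Lemma measurable_power_sum n r : measurable_fun setT (@power_sum n r).
Proof.
apply: measurable_sum => i; apply: (measurableT_comp (measurable_powRl r)).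
by apply: measurableT_comp => //; exact: measurable_tnth.
Qed.

Lemma power_sum_ge0 n r (x : Rn R n) : 0 <= power_sum r x.
Proof. by apply: sumr_ge0 => i _; exact: powR_ge0. Qed.

Lemma power_sum_scale n r s (x : Rn R n) : 0 <= s ->
  power_sum r (Rn_scale s x) = s `^ r * power_sum r x.
Proof.
move=> s0; rewrite /power_sum mulr_sumr; apply: eq_bigr => i _.
by rewrite tnth_mktuple normrM (ger0_norm s0) powRM.
Qed.

(** The layer-cake formula: rescaling by t^(1/r) turns the integral of [f] over
    the sublevel set at [t] into t^((n+p)/r) times the one over the unit ball. *)
Lemma polar_power_sum n (r p : R) (f : Rn R n -> R) : 0 < r ->
  measurable_fun setT f -> (forall x, 0 <= f x) ->
  (forall s x, 0 < s -> f (Rn_scale s x) = s `^ p * f x) ->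
  (\int[lebesgue_measure_Rn n]_x (f x * expR (- power_sum r x))%:E =
   \int[lebesgue_measure_Rn n]_x (f x * (power_sum r x <= 1)%R%:R)%:E *
   gamma_integral ((n%:R + p) / r))%E.
Proof.
move=> r0 mf f0 fp; apply: layer_cake_expR => //.
- exact: measurable_power_sum.
- exact: power_sum_ge0.
- by apply: integral_ge0 => x _; rewrite lee_fin mulr_ge0.
move=> t t0; pose s := t `^ r^-1.
have s0 : 0 < s by exact: powR_gt0.
have sr : s `^ r = t by rewrite -powRrM mulVf ?gt_eqF// powRr1// ltW.
have mN := @measurable_power_sum n r.
have mfN u : measurable_fun setT (fun x => f x * (power_sum r x <= u)%R%:R).
  by apply: measurable_funM => //; exact: measurable_ind_le.
rewrite (@ge0_integral_Rn_scale n s (fun x => (f x * (power_sum r x <= t)%R%:R)%:E) s0);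
  last 2 first.
- exact/measurable_EFinP.
- by move=> x; rewrite lee_fin mulr_ge0.
transitivity ((s ^+ n)%:E * ((s `^ p)%:E *
  \int[lebesgue_measure_Rn n]_x (f x * (power_sum r x <= 1)%R%:R)%:E))%E.
  congr (_ * _)%E; rewrite -(ge0_integralZl_real _ (powR_ge0 _ _)) //.
    apply: eq_integral => x _; rewrite (fp _ _ s0) (power_sum_scale _ _ (ltW s0)) sr mulrA.
    by rewrite -[X in (_ <= X)%R](mulr1 t) ler_pM2l.
  by move=> x; rewrite mulr_ge0.
rewrite muleA -EFinM; congr (_%:E * _)%E.
rewrite -powR_mulrn ?(ltW s0)// -powRD; last by rewrite (gt_eqF s0) implybT.
by rewrite -powRrM mulrC.
Qed.

(** The polar formula in dimension 0. *)
Lemma gamma_integral0 : gamma_integral 0 = 1%E :> \bar R.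
Proof.
have := @polar_power_sum 0 1 0 (fun=> 1) ltr01 (measurable_cst _) (fun=> ler01).
have mN := @measurable_power_sum 0 1.
have m1 : measurable_fun setT (fun x : Rn R 0 => (1 * expR (- power_sum 1 x))%:E).
  apply/measurable_EFinP; apply: measurable_funM => //.
  exact: (measurableT_comp measurable_expRN mN).
have m2 : measurable_fun setT (fun x : Rn R 0 => ((1 : R) * (power_sum 1 x <= 1)%R%:R)%:E).
  apply/measurable_EFinP; apply: measurable_funM => //.
  exact: measurable_ind_le.
rewrite (ge0_integral_Rn0 m1); last by move=> x; rewrite lee_fin mul1r expR_ge0.
rewrite (ge0_integral_Rn0 m2); last by move=> x; rewrite lee_fin mul1r.
rewrite /power_sum !big_ord0 oppr0 expR0 ler01 !mulr1 addr0 mul0r mul1e => <-//.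
by move=> s x s0; rewrite powRr0 mulr1.
Qed.

End polar.

(** * The densities exp(-|x|^q) and the Gaussian densities *)

Section densities.
Context {R : realType}.
Local Notation mu := (@lebesgue_measure R).
Implicit Types (q : \bar R) (s r x y z : R).

Lemma measurable_growth s : measurable_fun setT (fun x : R => (1 + `|x|) `^ s).
Proof.
apply: (measurableT_comp (measurable_powRl s)).
by apply: measurable_funD; [exact: measurable_cst|exact: normr_measurable].
Qed.

(** (1 + |x|)^s <= exp(s |x|), and s |x| <= (k/2) x^2 + s^2 / (2 k). *)
Lemma gauss_moment_rintegrable s (k : R) : 0 <= s -> 0 < k ->
  rintegrable (fun x => (1 + `|x|) `^ s * expR (- (k * x ^+ 2))).
Proof.
move=> s0 k0; pose a := Num.sqrt (k / 2).
have k20 : 0 < k / 2 by rewrite divr_gt0.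
have a0 : a != 0 by rewrite gt_eqF// sqrtr_gt0.
have gi : rintegrable (fun x => expR (s ^+ 2 / (2 * k)) * gauss_fun (a * x + 0)).
  apply: rintegrableZ; apply: (@rintegrable_affine _ a 0 gauss_fun a0).
  exact: integrableT_gauss.
apply: ge0_rintegrable gi.
- apply: measurable_funM; first exact: measurable_growth.
  apply: (measurableT_comp measurable_expRN).
  by apply: measurable_funM; [exact: measurable_cst|exact: exprn_measurable].
move=> x; rewrite mulr_ge0 ?powR_ge0 ?expR_ge0//= addr0.
have H1 : (1 + `|x|) `^ s <= expR (s * `|x|).
  have -> : expR (s * `|x|) = expR `|x| `^ s.
    by rewrite /powR gt_eqF ?expR_gt0// expRK.
  apply: ge0_ler_powR => //; rewrite ?nnegrE ?expR_ge0 ?addr_ge0//.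
  exact: expR_ge1Dx.
apply: le_trans (ler_wpM2r (expR_ge0 _) H1) _.
rewrite /gauss_fun -!expRD ler_expR exprMn sqr_sqrtr ?(ltW k20)//.
rewrite -(real_normK (num_real x)).
have : 0 <= (s - k * `|x|) ^+ 2 / (2 * k) by rewrite divr_ge0 ?sqr_ge0// mulr_ge0// ltW.
have -> : (s - k * `|x|) ^+ 2 / (2 * k) =
   s ^+ 2 / (2 * k) - s * `|x| + k / 2 * `|x| ^+ 2 by field; rewrite gt_eqF.
lra.
Qed.

(** The product of these densities over the coordinates is constant on the
    spheres of l_q (finite [q]), or the indicator of the cube ([q = +oo]). *)
Definition lq_density q x : R :=
  match q with
  | r%:E => expR (- `|x| `^ r)
  | _ => (`|x| <= 1)%R%:R
  end.

Lemma ge2_cases q : (2%:E <= q)%E -> (exists2 r, q = r%:E & 2 <= r) \/ q = +oo%E.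
Proof.
case: q => [r| |]; [|by right|by rewrite leeNy_eq].
by rewrite lee_fin => r2; left; exists r.
Qed.

Lemma lq_density_ge0 q x : 0 <= lq_density q x.
Proof. by case: q => [r| |] //=; exact: expR_ge0. Qed.

Lemma lq_density_even q : even_fun (lq_density q).
Proof. by move=> x; case: q => [r| |] /=; rewrite normrN. Qed.

Lemma measurable_lq_density q : measurable_fun setT (lq_density q).
Proof.
case: q => [r| |] /=.
- apply: (measurableT_comp measurable_expRN).
  by apply: (measurableT_comp (measurable_powRl r)).
- by apply: measurable_ind_le => //; exact: normr_measurable.
- by apply: measurable_ind_le => //; exact: normr_measurable.
Qed.

Lemma lq_density_noninc q x y : (2%:E <= q)%E -> `|x| <= `|y| -> lq_density q y <= lq_density q x.
Proof.
move=> /ge2_cases[[r -> r2]|->] xy; rewrite /lq_density.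
  rewrite ler_expR lerN2; apply: ge0_ler_powR; rewrite ?nnegrE//; lra.
by rewrite ler_nat; case: (leP `|y|) => // y1; rewrite (le_trans xy y1).
Qed.

Lemma abs_pow_four_points r x y x' y' : 2 <= r ->
  x ^+ 2 + y ^+ 2 = x' ^+ 2 + y' ^+ 2 ->
  Num.max `|x| `|y| <= Num.max `|x'| `|y'| ->
  abs_pow r x + abs_pow r y <= abs_pow r x' + abs_pow r y'.
Proof.
move=> r2; apply: square_convex_four_points; first exact: abs_pow_even.
exact: abs_pow_square_convex.
Qed.

(** For finite [q] this is the convexity of u |-> u^(q/2); for [q = +oo] the
    product is the indicator of max(|x|, |y|) <= 1. *)
Lemma lq_density_rotation q : (2%:E <= q)%E -> rotation_decreasing (lq_density q).
Proof.
move=> /ge2_cases[[r -> r2]|->] x y x' y' E m; rewrite /lq_density.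
  by rewrite -!expRD ler_expR -!opprD lerN2; exact: (abs_pow_four_points r2 E m).
have [x1|x1] := leP `|x'| 1; last by rewrite mul0r mulr_ge0.
have [y1|y1] := leP `|y'| 1; last by rewrite mulr0 mulr_ge0.
have : Num.max `|x| `|y| <= 1 by apply: (le_trans m); rewrite ge_max x1.
by rewrite ge_max => /andP[-> ->].
Qed.

(** This domination by a Gaussian gives all moments at once. *)
Lemma lq_density_le q x : (2%:E <= q)%E -> lq_density q x <= expR (1 - x ^+ 2).
Proof.
rewrite -(real_normK (num_real x)).
move=> /ge2_cases[[r -> r2]|->]; rewrite /lq_density.
  rewrite ler_expR; have [x1|x1] := leP 1 `|x|.
    have : `|x| `^ 2%:R <= `|x| `^ r by apply: ler_powR.
    by rewrite powR_mulrn//; lra.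
  by have := powR_ge0 `|x| r; have := normr_ge0 x; nra.
have [x1|x1] := leP `|x| 1; last exact: expR_ge0.
apply: le_trans (expR_ge1Dx _).
have : `|x| ^+ 2 <= 1 by rewrite exprn_ile1.
by rewrite [true%:R]/=; lra.
Qed.

Lemma lq_density_ge q x : (2%:E <= q)%E -> expR (- 1) * (`|x| <= 1)%R%:R <= lq_density q x.
Proof.
move=> hq; have [x1|x1] := leP `|x| 1; last by rewrite mulr0 lq_density_ge0.
move: hq => /ge2_cases[[r -> r2]|->]; rewrite /lq_density mulr1.
  rewrite ler_expR lerN2 -[leRHS](congr1 (@^~ r) (@powR1 R)).
  by apply: ge0_ler_powR; rewrite ?nnegrE//; lra.
by rewrite x1 -[leRHS]expR0 ler_expR; lra.
Qed.

Lemma lq_density_moment q s : (2%:E <= q)%E -> 0 <= s ->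
  rintegrable (fun x => (1 + `|x|) `^ s * lq_density q x).
Proof.
move=> hq s0; have := rintegrableZ (expR 1) (gauss_moment_rintegrable s0 ltr01).
apply: ge0_rintegrable.
  by apply: measurable_funM; [exact: measurable_growth|exact: measurable_lq_density].
move=> x; rewrite mulr_ge0 ?powR_ge0 ?lq_density_ge0//=.
rewrite mulrCA ler_wpM2l ?powR_ge0// -expRD mul1r; exact: lq_density_le.
Qed.

Lemma lq_density_rintegrable q : (2%:E <= q)%E -> rintegrable (lq_density q).
Proof.
move=> hq; have := lq_density_moment hq (lexx 0).
by under [X in rintegrable X]eq_fun do rewrite powRr0 mul1r.
Qed.

Definition lq_mass q := \int[mu]_x lq_density q x.

Lemma lq_mass_gt0 q : (2%:E <= q)%E -> 0 < lq_mass q.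
Proof.
move=> hq; rewrite -lte_fin EFin_Rintegral; last exact: lq_density_rintegrable.
apply: (@lt_le_trans _ _ ((expR (- 1))%:E * \int[mu]_x ((`|x| <= 1)%R%:R)%:E)%E).
  have -> : (\int[mu]_x ((`|x| <= 1)%R%:R)%:E = \int[mu]_(x in `[(-1)%R, 1%R]) (cst 1%E x))%E.
    rewrite [RHS]integral_mkcond; apply: eq_integral => x _.
    by rewrite patchE mem_setE in_itv/= ler_norml; case: (_ && _).
  rewrite integral_cst// mul1e /= lebesgue_measure_itv/= lte_fin.
  rewrite (_ : -1 < 1 :> R)%R; last by lra.
  by rewrite -EFinD -EFinM lte_fin mulr_gt0 ?expR_gt0//; lra.
rewrite -(ge0_integralZl_real mu (expR_ge0 _)); last 2 first.
- by apply: measurable_ind_le => //; exact: normr_measurable.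
- by [].
have mI : measurable_fun setT (fun x : R => expR (- 1) * (`|x| <= 1)%R%:R : R).
  apply: measurable_funM; first exact: measurable_cst.
  by apply: measurable_ind_le => //; exact: normr_measurable.
apply: (ge0_le_integral mu measurableT).
- by move=> x _; rewrite lee_fin mulr_ge0 ?expR_ge0.
- exact/measurable_EFinP.
- by apply/measurable_EFinP; exact: measurable_lq_density.
- by move=> x _; rewrite lee_fin lq_density_ge.
Qed.

Definition lq_weight q x := (lq_mass q)^-1 * lq_density q x.

Lemma lq_weightP q : (2%:E <= q)%E -> weight (lq_weight q).
Proof.
move=> hq; have Z0 := lq_mass_gt0 hq.
have Zi : 0 <= (lq_mass q)^-1 by rewrite invr_ge0 ltW.
split.
- by apply: measurable_funM => //; exact: measurable_lq_density.
- by move=> x; rewrite mulr_ge0 ?lq_density_ge0.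
- by move=> x; rewrite /lq_weight lq_density_even.
- by move=> x y xy; rewrite ler_wpM2l// lq_density_noninc.
- move=> s s0; have := rintegrableZ (lq_mass q)^-1 (lq_density_moment hq s0).
  by congr rintegrable; apply/funext => x; rewrite mulrCA.
- by rewrite (RintegralZl _ measurableT (lq_density_rintegrable hq)) mulVf// gt_eqF.
Qed.

Lemma lq_weight_rotation q : (2%:E <= q)%E -> rotation_decreasing (lq_weight q).
Proof.
move=> hq x y x' y' E m; rewrite /lq_weight.
rewrite (mulrACA _ (lq_density q x')) (mulrACA _ (lq_density q x)) ler_wpM2l//.
  by rewrite mulr_ge0// invr_ge0 ltW// lq_mass_gt0.
exact: (lq_density_rotation hq E).
Qed.

Section gaussian.
Variable c : R.
Hypothesis c0 : 0 < c.

(** The centered Gaussian density of variance 1 / (2 c^2). *)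
Definition gauss_weight x := c / Num.sqrt pi * gauss_fun (c * x).

Let sqrtpi : 0 < Num.sqrt pi :> R. Proof. by rewrite sqrtr_gt0 pi_gt0. Qed.
Let cn0 : c != 0. Proof. by rewrite gt_eqF. Qed.
Let k0 : 0 <= c / Num.sqrt pi. Proof. by rewrite divr_ge0// ltW. Qed.

Lemma gauss_integral_scale (f : R -> R) : (forall x, 0 <= f x) ->
  rintegrable (fun x => f x * gauss_fun x) ->
  \int[mu]_x (f (c * x) * gauss_weight x) =
  (Num.sqrt pi)^-1 * \int[mu]_x (f x * gauss_fun x).
Proof.
move=> f0 fi.
have A := @Rintegral_affine R c 0 (fun x => f x * gauss_fun x) cn0
  (rintegrable_measurable fi) (fun x => mulr_ge0 (f0 x) (gauss_fun_ge0 x)).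
have B := RintegralZl (c / Num.sqrt pi) measurableT (rintegrable_affine 0 cn0 fi).
transitivity (\int[mu]_x (c / Num.sqrt pi * (f (c * x + 0) * gauss_fun (c * x + 0)))).
  by apply: eq_Rintegral => x _; rewrite addr0 /gauss_weight mulrCA.
rewrite B A (gtr0_norm c0) mulrA; congr (_ * _).
by field; rewrite !gt_eqF.
Qed.

Lemma gauss_weightP : weight gauss_weight.
Proof.
have g0 x : 0 <= gauss_weight x by rewrite mulr_ge0 ?gauss_fun_ge0.
have mg : measurable_fun setT gauss_weight.
  apply: measurable_funM => //; apply: (measurableT_comp measurable_gauss_fun).
  exact: measurable_funM.
split.
- exact: mg.
- exact: g0.
- by move=> x; rewrite /gauss_weight /gauss_fun mulrN sqrrN.
- move=> x y xy; rewrite /gauss_weight ler_wpM2l// ler_expR lerN2 !exprMn.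
  rewrite ler_wpM2l ?sqr_ge0// -(real_normK (num_real x)) -(real_normK (num_real y)).
  by rewrite ler_pXn2r ?nnegrE.
- move=> s s0; have c2 : 0 < c ^+ 2 by rewrite exprn_gt0.
  have := rintegrableZ (c / Num.sqrt pi) (gauss_moment_rintegrable s0 c2).
  congr rintegrable; apply/funext => x.
  by rewrite /gauss_weight /gauss_fun exprMn mulrCA.
- have gi : rintegrable (fun x => 1 * gauss_fun x).
    by under [X in rintegrable X]eq_fun do rewrite mul1r; exact: integrableT_gauss.
  have := gauss_integral_scale (fun=> ler01) gi.
  under eq_Rintegral do rewrite mul1r; move=> ->.
  under eq_Rintegral do rewrite mul1r.
  by rewrite /Rintegral integralT_gauss/= mulVf// gt_eqF.
Qed.

Lemma gauss_weight_rotation x y x' y' : x ^+ 2 + y ^+ 2 = x' ^+ 2 + y' ^+ 2 ->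
  gauss_weight x * gauss_weight y = gauss_weight x' * gauss_weight y'.
Proof.
move=> E; rewrite /gauss_weight (mulrACA _ (gauss_fun _)) [RHS](mulrACA _ (gauss_fun _)).
congr (_ * _).
rewrite /gauss_fun -!expRD; congr expR.
by rewrite !exprMn -!opprD -!mulrDr E.
Qed.

End gaussian.
End densities.

(** * Comparison with the Gaussian density *)

Section gaussian_comparison.
Context {R : realType}.
Local Notation mu := (@lebesgue_measure R).
Implicit Types (q : \bar R) (s r x y z c p : R).

Let sqrtpi : 0 < Num.sqrt pi :> R. Proof. by rewrite sqrtr_gt0 pi_gt0. Qed.

(** The layer-cake formula for f = 1 and N x = x^2 applied to the known value of
    the Gaussian integral. *)
Lemma gamma_integral_half : gamma_integral (2^-1 : R) = (Num.sqrt pi / 2)%:E.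
Proof.
have E : (\int[mu]_x (1 * expR (- x ^+ 2))%:E = 2%:E * gamma_integral (2^-1 : R))%E.
  apply: (@layer_cake_expR _ _ _ mu (fun=> 1) (fun x => x ^+ 2)) => //.
    by move=> x; exact: sqr_ge0.
  move=> t t0; rewrite powR12_sqrt ?(ltW t0)//; set a := Num.sqrt t.
  have a0 : 0 < a by rewrite sqrtr_gt0.
  transitivity (\int[mu]_(x in `[(- a)%R, a]) (cst 1%E x))%E.
    rewrite [RHS]integral_mkcond; apply: eq_integral => x _.
    rewrite patchE mem_setE in_itv/= -ler_norml mul1r.
    have -> : (x ^+ 2 <= t) = (`|x| <= a).
      have -> : t = a ^+ 2 by rewrite sqr_sqrtr ?(ltW t0).
      by rewrite -(real_normK (num_real x)) ler_pXn2r ?nnegrE ?(ltW a0).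
    by case: (_ <= _).
  rewrite integral_cst//= mul1e lebesgue_measure_itv/= lte_fin.
  rewrite (_ : - a < a)%R; last by lra.
  by rewrite -EFinD -EFinM; congr EFin; ring.
have : (\int[mu]_x (1 * expR (- x ^+ 2))%:E = (Num.sqrt pi)%:E)%E.
  by rewrite -integralT_gauss; apply: eq_integral => x _; rewrite mul1r.
rewrite E; case: (gamma_integral _) => [v| |].
- by rewrite -EFinM => -[<-]; congr EFin; field.
- by rewrite gt0_muley ?lte_fin.
- by rewrite gt0_muleNy ?lte_fin.
Qed.

Lemma powR_gauss_rintegrable p : 1 <= p ->
  rintegrable (fun x : R => `|x| `^ p * gauss_fun x).
Proof.
move=> p1; have p0 : 0 <= p by lra.
have := gauss_moment_rintegrable p0 (ltr01 : 0 < (1:R)).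
apply: ge0_rintegrable.
  apply: measurable_funM; last exact: measurable_gauss_fun.
  by apply: (measurableT_comp (measurable_powRl p)); exact: normr_measurable.
move=> x; rewrite mulr_ge0 ?powR_ge0 ?gauss_fun_ge0//= /gauss_fun mul1r.
by rewrite ler_wpM2r ?expR_ge0//; apply: ge0_ler_powR; rewrite ?nnegrE ?addr_ge0// lerDr.
Qed.

Lemma gauss_weight_moment c p : 0 < c -> 1 <= p ->
  \int[mu]_x (`|x| `^ p * gauss_weight c x) =
  c^-1 `^ p * (Gamma ((p + 1) / 2) / Num.sqrt pi).
Proof.
move=> c0 p1; have ci : 0 <= c^-1 by rewrite invr_ge0 ltW.
have W := gauss_weightP c0.
have fi := powR_gauss_rintegrable p1.
have := gauss_integral_scale c0 (fun x => powR_ge0 `|x| p) fi.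
have -> : \int[mu]_x (`|x| `^ p * gauss_fun x) = Gamma ((p + 1) / 2).
  by rewrite Gamma_gamma_integral -integral_powR_gauss.
move=> E; rewrite (mulrC (Gamma _)) -E -RintegralZl//.
  apply: eq_Rintegral => x _; rewrite mulrA -powRM//; congr (_ `^ _ * _).
  by rewrite normrM (gtr0_norm c0) mulKf// gt_eqF.
have := rintegrable_affine 0 (lt0r_neq0 c0) fi.
move/(rintegrableZ (c / Num.sqrt pi)); congr rintegrable; apply/funext => x.
by rewrite addr0 /gauss_weight mulrCA.
Qed.

Lemma gauss_weight_second_moment c : 0 < c ->
  \int[mu]_x (x ^+ 2 * gauss_weight c x) = (2 * c ^+ 2)^-1.
Proof.
move=> c0; have ci : 0 <= c^-1 by rewrite invr_ge0 ltW.
transitivity (\int[mu]_x (`|x| `^ 2 * gauss_weight c x)).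
  apply: eq_Rintegral => x _.
  by rewrite (powR_mulrn 2)// real_normK ?num_real.
rewrite gauss_weight_moment ?ler1n// Gamma_gamma_integral.
rewrite (_ : (2 + 1) / 2 - 1 = 2^-1 :> R); last by field.
rewrite gamma_integral_half/= (powR_mulrn 2)//.
by field; rewrite !gt_eqF.
Qed.

Definition abs_moment p q := \int[mu]_x (abs_pow p x * lq_weight q x).

Lemma abs_pow_rintegrable p w : 0 <= p -> weight w ->
  rintegrable (fun x => abs_pow p x * w x).
Proof.
move=> p0 W; have := weight_moment W p0; apply: ge0_rintegrable.
  apply: measurable_funM; last exact: weight_measurable.
  by apply: (measurableT_comp (measurable_powRl p)); exact: normr_measurable.
move=> x; rewrite mulr_ge0 ?powR_ge0 ?(weight_ge0 W)//=.
rewrite ler_wpM2r ?(weight_ge0 W)//.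
by apply: ge0_ler_powR; rewrite ?nnegrE ?addr_ge0// lerDr.
Qed.

Lemma abs_moment_gt0 p q : 0 <= p -> (2%:E <= q)%E -> 0 < abs_moment p q.
Proof.
move=> p0 hq; have W := lq_weightP hq; have Z0 := lq_mass_gt0 hq.
have ip := abs_pow_rintegrable p0 W.
rewrite -lte_fin EFin_Rintegral//.
pose k := (lq_mass q)^-1 * expR (- 1).
have k0 : 0 < k by rewrite mulr_gt0 ?invr_gt0 ?expR_gt0.
have mI : measurable_fun setT (fun s : R => (0 < s)%R%:R * (s <= 1)%R%:R * s `^ p : R).
  apply: measurable_funM; last exact: measurable_powRl.
  by apply: measurable_funM; [exact: measurable_ind_lt|exact: measurable_ind_le].
have I0 s : 0 <= (0 < s)%R%:R * (s <= 1)%R%:R * s `^ p :> R.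
  by rewrite !mulr_ge0 ?powR_ge0.
have ki : measurable_fun setT (fun s : R => k * ((0 < s)%R%:R * (s <= 1)%R%:R * s `^ p) : R).
  by apply: measurable_funM.
apply: (@lt_le_trans _ _ (k%:E * (1 `^ (p + 1) / (p + 1))%:E)%E).
  by rewrite -EFinM lte_fin mulr_gt0// divr_gt0 ?powR_gt0//; lra.
rewrite -integral_powR_itv// -(ge0_integralZl_real mu (ltW k0))//.
apply: (ge0_le_integral mu measurableT).
- by move=> x _; rewrite lee_fin mulr_ge0 ?(ltW k0).
- exact/measurable_EFinP.
- by apply/measurable_EFinP; exact: (rintegrable_measurable ip).
move=> x _; rewrite lee_fin /k /lq_weight -(mulrA (lq_mass q)^-1) [leRHS]mulrCA.
rewrite ler_wpM2l ?invr_ge0 ?(ltW Z0)//.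
have [x0|x0] := ltP 0 x; last by rewrite !mul0r mulr0 mulr_ge0 ?powR_ge0 ?lq_density_ge0.
have := ler_wpM2l (powR_ge0 `|x| p) (lq_density_ge x hq).
rewrite /abs_pow (gtr0_norm x0) mul1r => H.
by apply: le_trans H; rewrite [leLHS]mulrA [leLHS]mulrC.
Qed.

Definition second_moment q := \int[mu]_x (x ^+ 2 * lq_weight q x).

Lemma abs_pow2 x : abs_pow 2 x = x ^+ 2.
Proof. by rewrite /abs_pow (powR_mulrn 2)// real_normK ?num_real. Qed.

Lemma second_momentE q : second_moment q = abs_moment 2 q.
Proof. by apply: eq_Rintegral => x _; rewrite abs_pow2. Qed.

Lemma second_moment_gt0 q : (2%:E <= q)%E -> 0 < second_moment q.
Proof. by move=> hq; rewrite second_momentE abs_moment_gt0. Qed.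

(** After taking logarithms, this says that the density exp(-|x|^r) exceeds a
    multiple of a Gaussian density on an interval. *)
Lemma powR_crossing r x y z (k d : R) : 2 <= r -> 0 <= x -> x <= y -> y <= z ->
  x `^ r < k * x ^+ 2 + d -> z `^ r < k * z ^+ 2 + d -> y `^ r < k * y ^+ 2 + d.
Proof.
move=> r2 x0 xy yz hx hz.
have [xz|zx] := ltP x z; last by have -> : y = x by lra.
have y0 := le_trans x0 xy; have z0 := le_trans y0 yz.
have := abs_pow_square_convex r2 x0 xy yz; rewrite /abs_pow !ger0_norm//.
have d1 : 0 < z ^+ 2 - x ^+ 2 by nra.
have d2 : 0 <= z ^+ 2 - y ^+ 2 by nra.
have d3 : 0 <= y ^+ 2 - x ^+ 2 by nra.
move=> H; rewrite -(ltr_pM2l d1); apply: (le_lt_trans H).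
have [e|e] := ltP 0 (z ^+ 2 - y ^+ 2).
  have := ler_wpM2l d3 (ltW hz); have := hx; rewrite -(ltr_pM2l e); lra.
have e' : 0 < y ^+ 2 - x ^+ 2 by lra.
have := ler_wpM2l d2 (ltW hx); have := hz; rewrite -(ltr_pM2l e'); lra.
Qed.

Lemma powR_dominates r (k d : R) : 2 < r ->
  exists2 M, 1 <= M & forall x, M <= x -> k * x ^+ 2 + d <= x `^ r.
Proof.
move=> r2; have r20 : 0 < r - 2 by lra.
pose A := `|k| + `|d|.
have A0 : 0 <= A by rewrite addr_ge0.
exists (Num.max 1 (A `^ (r - 2)^-1)); first by rewrite le_max lexx.
move=> x; rewrite ge_max => /andP[x1 xA].
have x0 : 0 < x by lra.
have -> : x `^ r = x ^+ 2 * x `^ (r - 2).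
  rewrite -(powR_mulrn 2) ?(ltW x0)// -powRD; last by rewrite (gt_eqF x0) implybT.
  by congr (_ `^ _); ring.
have : A <= x `^ (r - 2).
  have -> : A = (A `^ (r - 2)^-1) `^ (r - 2).
    by rewrite -powRrM mulVf ?gt_eqF// powRr1.
  by apply: ge0_ler_powR; rewrite ?nnegrE ?powR_ge0 ?(ltW x0) ?(ltW r20).
have x2 : 1 <= x ^+ 2 by rewrite exprn_ege1.
have := ler_norm k; have := ler_norm d; rewrite /A.
move: `|k| `|d| (normr_ge0 k) (normr_ge0 d) => K D K0 D0 dD kK AB.
have := ler_wpM2l (le_trans ler01 x2) AB.
have := ler_wpM2r (le_trans ler01 x2) kK.
have := ler_wpM2l D0 x2; lra.
Qed.

(** The Gaussian density has the variance of [lq_weight q]. For [q = 2] the two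
    densities coincide; otherwise they cross as required by
    [average_le_crossing]. *)
Lemma average_lq_le_gauss q r h (a : R) : (2%:E <= q)%E -> 0 <= r ->
  admissible r h ->
  average (lq_weight q) a h 0 <=
  average (gauss_weight (Num.sqrt (2 * second_moment q))^-1) a h 0.
Proof.
move=> hq r0 H; have m0 := second_moment_gt0 hq.
set c := (Num.sqrt _)^-1.
have c0 : 0 < c by rewrite invr_gt0 sqrtr_gt0 mulr_gt0.
have m2E : (2 * c ^+ 2)^-1 = second_moment q.
  rewrite /c exprVn sqr_sqrtr ?mulr_ge0 ?(ltW m0)//.
  by field; rewrite gt_eqF.
have Z0 := lq_mass_gt0 hq.
have G0 : 0 < c / Num.sqrt pi by rewrite divr_gt0.
have mom2 : \int[mu]_x (x ^+ 2 * lq_weight q x) = \int[mu]_x (x ^+ 2 * gauss_weight c x).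
  by rewrite gauss_weight_second_moment// m2E.
have GW := gauss_weightP c0; have W := lq_weightP hq.
have [[s qE s2]|qE] := ge2_cases hq.
  have gw x : (gauss_weight c x < lq_weight q x) =
      (`|x| `^ s < c ^+ 2 * `|x| ^+ 2 + (- ln (lq_mass q) - ln (c / Num.sqrt pi))).
    rewrite /gauss_weight /lq_weight qE /= -qE.
    rewrite -{1}(lnK (G0 : c / Num.sqrt pi \is Num.pos)).
    rewrite -{1}(lnK (Z0 : lq_mass q \is Num.pos)) -expRN -!expRD ltr_expR.
    rewrite exprMn -(real_normK (num_real x)).
    by apply/idP/idP; lra.
  have [s2'|s2'] := ltP 2 s.
    apply: (average_le_crossing a W GW r0 H mom2).
      move=> x y z x0 xy yz; rewrite !gw !ger0_norm//; try lra.
      exact: powR_crossing.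
    have [M M1 HM] := powR_dominates (c ^+ 2)
      (- ln (lq_mass q) - ln (c / Num.sqrt pi)) s2'.
    exists M => x Mx; rewrite leNgt gw ger0_norm; last by lra.
    by rewrite -leNgt HM.
  have s2E : s = 2 by lra.
  have oE x : lq_density q x = gauss_fun x.
    by rewrite qE /lq_density /gauss_fun s2E (powR_mulrn 2)// real_normK ?num_real.
  have mE : lq_mass q = Num.sqrt pi.
    rewrite /lq_mass; under eq_Rintegral do rewrite oE.
    by rewrite /Rintegral integralT_gauss.
  have wE x : lq_weight q x = gauss_weight 1 x.
    by rewrite /lq_weight /gauss_weight mE oE !mul1r.
  have c1 : c = 1.
    have : second_moment q = (2 * 1 ^+ 2)^-1.
      rewrite -gauss_weight_second_moment//.
      by apply: eq_Rintegral => x _; rewrite wE.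
    rewrite -m2E => /invr_inj/(mulfI (lt0r_neq0 (ltr0n R 2)))/eqP.
    by rewrite eqrXn2 ?ler01 ?(ltW c0)// => /eqP.
  by rewrite c1 (_ : lq_weight q = gauss_weight 1)//; apply/funext.
apply: (average_le_crossing a W GW r0 H mom2).
  move=> x y z x0 xy yz gx gz.
  have z1 : `|z| <= 1.
    rewrite leNgt; apply/negP => z1; move: gz.
    rewrite /lq_weight qE /= leNgt z1 mulr0 => /(le_lt_trans (weight_ge0 GW z)).
    by rewrite ltxx.
  have z0 : 0 <= z by lra.
  rewrite ger0_norm// in z1.
  have oE u : 0 <= u -> u <= 1 -> lq_weight q u = (lq_mass q)^-1.
    by move=> u0 u1; rewrite /lq_weight qE /= ger0_norm// u1 mulr1.
  rewrite oE; [|lra|lra]; rewrite -(oE x); [|lra|lra].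
  apply: le_lt_trans gx; apply: (weight_noninc GW).
  by rewrite !ger0_norm//; lra.
exists 2 => x x2; rewrite /lq_weight qE /=.
have -> : (`|x| <= 1) = false by apply/negbTE; rewrite -ltNge ger0_norm; lra.
by rewrite mulr0 (weight_ge0 GW).
Qed.

End gaussian_comparison.

(** * Moments of linear forms in independent coordinates *)

Section moments.
Context {R : realType}.
Local Notation mu := (@lebesgue_measure R).
Implicit Types (q : \bar R) (s r x y z c p : R).

Lemma admissible_abs_pow p : 2 <= p -> admissible p (@abs_pow R p).
Proof.
move=> p2; have p0 : 0 < p by lra.
split.
- exact: abs_pow_even.
- exact: continuous_abs_pow.
- by move=> x; exact: powR_ge0.
- exists 1 => // x; rewrite mul1r.
  by apply: ge0_ler_powR; rewrite ?nnegrE ?addr_ge0 ?(ltW p0)// lerDr.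
- exact: abs_pow_second_difference.
Qed.

Let continuous_one_sqr : continuous (fun x : R => 1 + x ^+ 2).
Proof.
by move=> x; apply: cvgD; [exact: cvg_cst|exact: exprn_continuous].
Qed.

Let one_sqr_growth x : 1 + x ^+ 2 <= 1 * (1 + `|x|) `^ 2.
Proof.
rewrite mul1r (powR_mulrn 2) ?addr_ge0// -(real_normK (num_real x)).
by have := normr_ge0 x; nra.
Qed.

Lemma admissible_one_sqr : admissible 2 (fun x : R => 1 + x ^+ 2).
Proof.
split.
- by move=> x; rewrite sqrrN.
- exact: continuous_one_sqr.
- by move=> x; rewrite addr_ge0 ?sqr_ge0.
- by exists 1 => // x; exact: one_sqr_growth.
- by move=> s x y _; rewrite le_eqVlt; apply/orP; left; apply/eqP; ring.
Qed.

Lemma abs_pow_le_one_sqr p x : 1 <= p <= 2 -> abs_pow p x <= 1 + x ^+ 2.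
Proof.
move=> /andP[p1 p2]; rewrite -abs_pow2 /abs_pow.
have [x1|x1] := leP 1 `|x|.
  by have := ler_powR x1 p2; lra.
have : `|x| `^ p <= 1.
  rewrite -[leRHS](congr1 (@^~ p) (@powR1 R)).
  by apply: ge0_ler_powR; rewrite ?nnegrE ?(ltW x1)//; lra.
by have := powR_ge0 `|x| 2; lra.
Qed.

Lemma admissible_one_sqr_sub_abs_pow p : 1 <= p <= 2 ->
  admissible 2 (fun x : R => 1 + x ^+ 2 - abs_pow p x).
Proof.
move=> p12; have p0 : 0 < p by lra.
split.
- by move=> x; rewrite sqrrN abs_pow_even.
- by move=> x; apply: cvgB; [exact: continuous_one_sqr|exact: continuous_abs_pow].
- by move=> x; rewrite subr_ge0 abs_pow_le_one_sqr.
- exists 1 => // x; apply: le_trans (one_sqr_growth x).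
  by rewrite lerBlDr lerDl powR_ge0.
- exact: sqr_sub_abs_pow_second_difference.
Qed.

Lemma average_abs_pow v p c : 0 <= p -> 0 <= c -> weight v ->
  average v c (abs_pow p) 0 = c `^ p * \int[mu]_x (abs_pow p x * v x).
Proof.
move=> p0 c0 v_; rewrite -RintegralZl//; last exact: abs_pow_rintegrable.
apply: eq_Rintegral => x _; rewrite add0r /abs_pow normrM (ger0_norm c0) powRM//.
by rewrite mulrA.
Qed.

Lemma average_one_sqr v c : 0 <= c -> weight v ->
  average v c (fun x : R => 1 + x ^+ 2) 0 = 1 + c ^+ 2 * \int[mu]_x (x ^+ 2 * v x).
Proof.
move=> c0 v_; have i1 := weight_rintegrable v_; have i2 := weight_square_rintegrable v_.
have iz := rintegrableZ (c ^+ 2) i2.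
rewrite -[in RHS](weight_mass v_) -(RintegralZl _ measurableT i2) -(RintegralD measurableT i1 iz).
by apply: eq_Rintegral => x _; rewrite add0r; ring.
Qed.

Lemma average_one_sqr_sub v p c : 1 <= p <= 2 -> 0 <= c -> weight v ->
  average v c (fun x : R => 1 + x ^+ 2 - abs_pow p x) 0 =
  1 + c ^+ 2 * \int[mu]_x (x ^+ 2 * v x) - c `^ p * \int[mu]_x (abs_pow p x * v x).
Proof.
move=> p12 c0 v_; have p0 : 0 <= p by lra.
rewrite -(average_one_sqr c0 v_) -(average_abs_pow p0 c0 v_).
have i2 := average_integrable v_ (ler0n R 2) c 0 admissible_one_sqr.
have ip : rintegrable (fun x => abs_pow p (0 + c * x) * v x).
  have := rintegrableZ (c `^ p) (abs_pow_rintegrable p0 v_).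
  congr rintegrable; apply/funext => x.
  by rewrite add0r /abs_pow normrM (ger0_norm c0) powRM// mulrA.
rewrite -(RintegralB measurableT i2 ip).
by apply: eq_Rintegral => x _; rewrite mulrBl.
Qed.

Section bounds.
Variables (q : \bar R) (hq : (2%:E <= q)%E) (n : nat) (a : 'I_n -> R).
Let w := lq_weight q.
Let V := euclidean_norm a.
Let g := gauss_weight (Num.sqrt (2 * second_moment q))^-1.
Let W : weight w := lq_weightP hq.

Let G : weight g.
Proof.
apply: gauss_weightP; rewrite invr_gt0 sqrtr_gt0 mulr_gt0//.
exact: second_moment_gt0.
Qed.

Let V0 : 0 <= V. Proof. exact: sqrtr_ge0. Qed.

Definition gauss_abs_moment p := \int[mu]_x (abs_pow p x * g x).

Let g2 : \int[mu]_x (x ^+ 2 * g x) = second_moment q.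
Proof.
have m0 := second_moment_gt0 hq.
rewrite gauss_weight_second_moment ?invr_gt0 ?sqrtr_gt0 ?mulr_gt0//.
by rewrite exprVn sqr_sqrtr ?mulr_ge0 ?(ltW m0)//; field; rewrite gt_eqF.
Qed.

Let bounds r h : 0 <= r -> admissible r h ->
  ((average w V h 0)%:E <= product_mean w h a)%E /\
  (product_mean w h a <= (average g V h 0)%:E)%E.
Proof.
move=> r0 H; split.
  exact: (product_mean_ge W r0 a (lq_weight_rotation hq) H).
apply: (product_mean_le W r0 a G _ _ H) => [x y x' y'|c h' H'].
  exact: gauss_weight_rotation.
exact: (average_lq_le_gauss c hq r0 H').
Qed.

Lemma moment_bounds_ge2 p : 2 <= p -> exists S,
  [/\ product_mean w (abs_pow p) a = S%:E, V `^ p * abs_moment p q <= S &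
      S <= V `^ p * gauss_abs_moment p].
Proof.
move=> p2; have p0 : 0 <= p by lra.
have [] := bounds p0 (admissible_abs_pow p2).
rewrite (average_abs_pow p0 V0 W) (average_abs_pow p0 V0 G).
case: (product_mean w (abs_pow p) a) => [S| |//]; last by rewrite leye_eq.
by rewrite !lee_fin; exists S.
Qed.

Lemma product_mean_one_sqr_split p : 1 <= p <= 2 ->
  (product_mean w (fun x => (1 + x ^+ 2)%R) a =
   product_mean w (fun x => (1 + x ^+ 2 - abs_pow p x)%R) a + product_mean w (abs_pow p) a)%E.
Proof.
move=> p12; have H2 := admissible_one_sqr_sub_abs_pow p12.
have pd0 (x : Rn R n) : 0 <= product_density w x.
  by apply: prodr_ge0 => i _; exact: weight_ge0 W _.
have mm (k : R -> R) : measurable_fun setT k ->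
    measurable_fun setT (fun x : Rn R n => (k (linear_form a x) * product_density w x)%:E).
  move=> mk; apply/measurable_EFinP; apply: measurable_funM.
    by apply: (measurableT_comp mk); exact: measurable_linear_form.
  exact: (measurable_product_density (weight_measurable W)).
rewrite /product_mean -ge0_integralD//.
- by apply: eq_integral => x _; rewrite -EFinD -mulrDl subrK.
- move=> x _; rewrite lee_fin mulr_ge0//; exact: admissible_ge0 H2 _.
- by apply: (mm (fun x => 1 + x ^+ 2 - abs_pow p x)); exact: admissible_measurable H2.
- by move=> x _; rewrite lee_fin mulr_ge0// powR_ge0.
- apply: mm; apply: (measurableT_comp (measurable_powRl p)); exact: normr_measurable.
Qed.

(** Both bounds give the same value to the mean of 1 + x^2; subtract from it the
    mean of 1 + x^2 - |x|^p. *)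
Lemma moment_bounds_le2 p : 1 <= p <= 2 -> exists S,
  [/\ product_mean w (abs_pow p) a = S%:E, V `^ p * gauss_abs_moment p <= S &
      S <= V `^ p * abs_moment p q].
Proof.
move=> p12; have H1 := admissible_one_sqr; have H2 := admissible_one_sqr_sub_abs_pow p12.
have r2 : (0:R) <= 2 by [].
have E1 : product_mean w (fun x => 1 + x ^+ 2) a = (1 + V ^+ 2 * second_moment q)%:E.
  have [] := bounds r2 H1.
  rewrite (average_one_sqr V0 W) (average_one_sqr V0 G) g2 => l1 l2.
  by apply/eqP; rewrite eq_le l1 l2.
have ED := product_mean_one_sqr_split p12.
have [] := bounds r2 H2.
rewrite (average_one_sqr_sub p12 V0 W) (average_one_sqr_sub p12 V0 G) g2.
move: ED; rewrite E1.
case: (product_mean w (fun x => 1 + x ^+ 2 - abs_pow p x) a) => [E| |]; last 2 first.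
- by move=> _ _; rewrite leye_eq.
- by move=> _; rewrite leeNy_eq.
case: (product_mean w (abs_pow p) a) => [S| |] //.
rewrite -EFinD => -[ES]; rewrite !lee_fin => l1 l2; exists S.
by split => //; rewrite -/(second_moment q) -/(gauss_abs_moment p) -/(abs_moment p q) in l1 l2; lra.
Qed.

End bounds.

Lemma product_mean_abs_pow_coordinate q n p : (2%:E <= q)%E -> 1 <= p ->
  product_mean (lq_weight q) (abs_pow p) (fun i : 'I_n.+1 => (i == ord0)%:R) =
  (abs_moment p q)%:E.
Proof.
move=> hq p1; have W := lq_weightP hq; have p0 : 0 <= p by lra.
have mE : average (lq_weight q) 1 (abs_pow p) 0 = abs_moment p q.
  by rewrite average_abs_pow// powR1 mul1r.
have [p2|p2] := leP 2 p.
  by rewrite (product_mean_coordinate W p0 _ (admissible_abs_pow p2)) mE.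
have p12 : 1 <= p <= 2 by rewrite p1 ltW.
have r2 : (0 : R) <= 2 by [].
have := product_mean_one_sqr_split hq (fun i : 'I_n.+1 => (i == ord0)%:R) p12.
rewrite (product_mean_coordinate W r2 _ admissible_one_sqr).
rewrite (product_mean_coordinate W r2 _ (admissible_one_sqr_sub_abs_pow p12)).
rewrite (average_one_sqr ler01 W) (average_one_sqr_sub p12 ler01 W) powR1 mul1r.
rewrite -/(abs_moment p q).
case: (product_mean _ _ _) => [S| |]; [|by []|by []].
rewrite -EFinD => -[E]; congr EFin.
by move: E; set u := _ * \int[mu]_x _; lra.
Qed.

End moments.

(** * The uniform distribution on the ball *)

Section ball.
Context {R : realType}.
Local Notation mu := (@lebesgue_measure R).
Implicit Types (q : \bar R) (s p : R).

(** For [q = +oo] the unnormalized product density is itself the indicator of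
    the ball. *)
Lemma lp_ball_indicator q n (x : Rn R n) : (2%:E <= q)%E ->
  \1_(lp_ball q n) x = (if q is r%:E then (power_sum r x <= 1)%R%:R
                        else product_density (lq_density q) x) :> R.
Proof.
move=> /ge2_cases[[r -> r2]|->]; rewrite indicE.
  by congr (_%:R); rewrite /lp_ball mem_setE.
rewrite /product_density /lq_density /=.
have [xK|xK] := pselect (forall i, `|tnth x i| <= 1).
  by rewrite mem_set//= big1// => i _; rewrite xK.
rewrite memNset//=; move/existsNP : xK => [i /negP xi].
by apply/esym/eqP/prodf_eq0; exists i => //; rewrite (negbTE xi).
Qed.

Lemma measurable_lp_ball q n : (2%:E <= q)%E -> measurable (lp_ball q n : set (Rn R n)).
Proof.
move=> hq.
suff : measurable_fun setT (\1_(lp_ball q n) : Rn R n -> R) by move/measurable_indicP.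
rewrite (_ : \1__ = fun x : Rn R n => (if q is r%:E then (power_sum r x <= 1)%R%:R
                        else product_density (lq_density q) x) : R); last first.
  by apply/funext => x; exact: lp_ball_indicator.
case: (ge2_cases hq) => [[r -> r2]|->].
  by apply: measurable_ind_le => //; exact: measurable_power_sum.
exact: (measurable_product_density (measurable_lq_density _)).
Qed.

Lemma integral_lp_ball q n (f : Rn R n -> R) :
  (\int[lebesgue_measure_Rn n]_(x in lp_ball q n) (f x)%:E =
   \int[lebesgue_measure_Rn n]_x (f x * \1_(lp_ball q n) x)%:E)%E.
Proof.
rewrite integral_mkcond; apply: eq_integral => x _.
by rewrite patchE indicE; case: ifP; rewrite ?mulr1 ?mulr0.
Qed.

Lemma product_density_lq_density_finite n r (x : Rn R n) :
  product_density (lq_density r%:E) x = expR (- power_sum r x).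
Proof. by rewrite /product_density /lq_density /power_sum -sumrN expR_sum. Qed.

Lemma polar_lp_ball q n p (f : Rn R n -> R) : (2%:E <= q)%E ->
  measurable_fun setT f -> (forall x, 0 <= f x) ->
  (forall s x, 0 < s -> f (Rn_scale s x) = s `^ p * f x) ->
  (\int[lebesgue_measure_Rn n]_x (f x * product_density (lq_density q) x)%:E =
   \int[lebesgue_measure_Rn n]_(x in lp_ball q n) (f x)%:E *
   gamma_integral ((n%:R + p) * fine q^-1))%E.
Proof.
move=> hq mf f0 fp; rewrite integral_lp_ball.
under [in RHS]eq_integral do rewrite (lp_ball_indicator _ hq).
case: (ge2_cases hq) => [[r -> r2]|->].
  have r0 : 0 < r by lra.
  rewrite inver gt_eqF//= -(polar_power_sum r0 mf f0 fp).
  by apply: eq_integral => x _; rewrite product_density_lq_density_finite.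
by rewrite invey /= mulr0 gamma_integral0 mule1.
Qed.

Lemma product_density_weight q n (x : Rn R n) :
  product_density (lq_weight q) x =
  (lq_mass q)^-1 ^+ n * product_density (lq_density q) x.
Proof.
by rewrite /product_density /lq_weight big_split/= prodr_const card_ord.
Qed.

Lemma pmule_finite (x y : \bar R) s : (0 <= x)%E -> (0 <= y)%E -> 0 < s ->
  (x * y = s%:E)%E -> exists u v, [/\ x = u%:E, y = v%:E, 0 < u & 0 < v].
Proof.
case: x => [u| |] //; case: y => [v| |] //; rewrite ?lee_fin => u0 v0 s0.
- rewrite -EFinM => -[uv]; exists u, v; split=> //.
    by rewrite lt_neqAle u0 andbT; apply/eqP => u00; rewrite -u00 mul0r in uv; lra.
  by rewrite lt_neqAle v0 andbT; apply/eqP => v00; rewrite -v00 mulr0 in uv; lra.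
- move: u0; rewrite le_eqVlt => /predU1P[<-|u0].
    by rewrite mul0e => -[s00]; rewrite -s00 ltxx in s0.
  by rewrite gt0_muley ?lte_fin.
- move: v0; rewrite le_eqVlt => /predU1P[<-|v0].
    by rewrite mule0 => -[s00]; rewrite -s00 ltxx in s0.
  by rewrite gt0_mulye ?lte_fin.
Qed.

Section homogeneous.
Variables (q : \bar R) (hq : (2%:E <= q)%E) (n : nat).
Let w := lq_weight q.
Let Zn := (lq_mass q)^-1 ^+ n.

Let Zn0 : 0 < Zn.
Proof. by rewrite exprn_gt0// invr_gt0 lq_mass_gt0. Qed.

Lemma product_mean_lp_ball p (f : Rn R n -> R) :
  measurable_fun setT f -> (forall x, 0 <= f x) ->
  (forall s x, 0 < s -> f (Rn_scale s x) = s `^ p * f x) ->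
  (\int[lebesgue_measure_Rn n]_x (f x * product_density w x)%:E =
   Zn%:E * \int[lebesgue_measure_Rn n]_(x in lp_ball q n) (f x)%:E *
   gamma_integral ((n%:R + p) * fine q^-1))%E.
Proof.
move=> mf f0 fp; rewrite -muleA -(polar_lp_ball hq mf f0 fp).
have pd0 (x : Rn R n) : 0 <= product_density (lq_density q) x.
  by apply: prodr_ge0 => i _; exact: lq_density_ge0.
rewrite -(ge0_integralZl_real _ (ltW Zn0)).
- by apply: eq_integral => x _; rewrite product_density_weight mulrCA.
- apply: measurable_funM => //.
  exact: (measurable_product_density (measurable_lq_density q)).
- by move=> x; rewrite mulr_ge0.
Qed.

Lemma gamma_integral_ge0 (y : R) : (0 <= gamma_integral y)%E.
Proof. by apply: integral_ge0 => t _; exact: gamma_integrand_ge0. Qed.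

(** The mean of [f] under the product density is a product of nonnegative
    extended reals. If it is positive and finite, so is each factor: this gives
    the finiteness of the volume of the ball and of the values of Gamma. *)
Lemma lp_ball_mean p (f : Rn R n -> R) S :
  measurable_fun setT f -> (forall x, 0 <= f x) ->
  (forall s x, 0 < s -> f (Rn_scale s x) = s `^ p * f x) -> 0 < S ->
  (\int[lebesgue_measure_Rn n]_x (f x * product_density w x)%:E = S%:E)%E ->
  let gam := gamma_integral ((n%:R + p) * fine q^-1) in
  exists u, [/\ 0 < u, 0 < fine gam, gam = (fine gam)%:E,
   (\int[lebesgue_measure_Rn n]_(x in lp_ball q n) (f x)%:E = u%:E)%E &
   S = Zn * u * fine gam].
Proof.
move=> mf f0 fp S0; rewrite (product_mean_lp_ball mf f0 fp) => E gam.
have I0 : (0 <= \int[lebesgue_measure_Rn n]_(x in lp_ball q n) (f x)%:E)%E.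
  by apply: integral_ge0 => x _; rewrite lee_fin.
have Z0 : (0 <= Zn%:E)%E by rewrite lee_fin ltW.
have [u [v [Eu Ev u0 v0]]] := pmule_finite (mule_ge0 Z0 I0) (gamma_integral_ge0 _) S0 E.
have [z [u' [[Ez] Eu' z0 u'0]]] := pmule_finite Z0 I0 u0 Eu.
exists u'; rewrite /gam Ev/=; split=> //.
by move: E; rewrite Eu' Ev -!EFinM => -[].
Qed.

End homogeneous.
End ball.

Section uniform_transfer.
Context {R : realType} d (T : measurableType d) (P : probability T R).
Variables (q : \bar R) (n : nat) (X : {RV P >-> Rn R n}).
Hypothesis hq : (2%:E <= q)%E.
Hypothesis hX : uniformly_distributed X (lp_ball q n).
Local Notation K := (lp_ball q n : set (Rn R n)).
Local Notation lam := (lebesgue_measure_Rn n).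

Lemma uniform_integral (f : Rn R n -> R) k : 0 < k -> lam K = k%:E ->
  measurable_fun setT f -> (forall x, 0 <= f x) ->
  (k%:E * \int[P]_t (f (X t))%:E = \int[lam]_(x in K) (f x)%:E)%E.
Proof.
move=> k0 lamK mf f0; have mK : measurable K by exact: measurable_lp_ball.
have mfE : measurable_fun setT (EFin \o f) by exact/measurable_EFinP.
have f0E x : (0 <= (EFin \o f) x)%E by rewrite lee_fin.
pose D := distribution P X.
have DE A : measurable A -> (k%:E * D A = lam (A `&` K))%E.
  move=> mA; rewrite /D hX// lamK inver gt_eqF// muleCA -EFinM divff ?gt_eqF//.
  by rewrite mule1.
have DCK : D (~` K) = 0%E.
  have := DE _ (measurableC mK); rewrite setICl measure0 => /eqP.
  by rewrite mule_eq0 eqe gt_eqF//= => /eqP.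
have -> : (\int[P]_t (f (X t))%:E = \int[D]_(x in K) (f x)%:E)%E.
  rewrite -(ge0_integral_distribution X mfE f0E) [RHS]integral_mkcond.
  apply: ae_eq_integral => //.
    exact/(measurable_restrictT _ _).1/measurable_funTS.
  exists (~` K); split => //; first exact: measurableC.
  move=> x /= /not_implyP[_ ne] Kx; apply: ne.
  by rewrite patchE mem_set.
pose kn : {nonneg R} := NngNum (ltW k0).
rewrite [RHS](eq_measure_integral (mscale kn D)).
  rewrite (ge0_integral_mscale _ mK kn (measurable_funTS mfE))//.
move=> A mA AK; transitivity (k%:E * D A)%E; last by [].
rewrite DE//.
by congr (lam _); apply/esym/setIidPl.
Qed.

End uniform_transfer.

Section lp_ball_moments.
Context {R : realType} d (T : measurableType d) (P : probability T R).
Variables (q : \bar R) (n : nat) (X : {RV P >-> Rn R n.+1}).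
Hypothesis hq : (2%:E <= q)%E.
Hypothesis hX : uniformly_distributed X (lp_ball q n.+1).
Implicit Types (p : R) (a : 'I_n.+1 -> R).
Local Notation lam := (lebesgue_measure_Rn n.+1).
Local Notation K := (lp_ball q n.+1 : set (Rn R n.+1)).
Let w := lq_weight q.

Let W : weight w := lq_weightP hq.
Let Gam p := Gamma ((n.+1%:R + p) * fine q^-1 + 1).

Let GamE p : Gam p = fine (gamma_integral ((n.+1%:R + p) * fine q^-1)).
Proof. by rewrite /Gam Gamma_gamma_integral addrK. Qed.

Let linear_form_scale a s x : linear_form a (Rn_scale s x) = s * linear_form a x.
Proof.
rewrite /linear_form mulr_sumr; apply: eq_bigr => i _.
by rewrite tnth_mktuple mulrCA.
Qed.

Let f p a (x : Rn R n.+1) := abs_pow p (linear_form a x).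

Let mf p a : measurable_fun setT (f p a).
Proof.
apply: (measurableT_comp (measurable_powRl p)).
by apply: measurableT_comp => //; exact: measurable_linear_form.
Qed.

Let f_ge0 p a x : 0 <= f p a x. Proof. exact: powR_ge0. Qed.

Let f_scale p a s x : 0 < s -> f p a (Rn_scale s x) = s `^ p * f p a x.
Proof.
move=> s0; rewrite /f linear_form_scale /abs_pow normrM (gtr0_norm s0).
by rewrite powRM// ltW.
Qed.

Let admissible1 : admissible 0 (fun=> 1 : R).
Proof.
split => //.
- by move=> x; exact: cvg_cst.
- by exists 1 => // x; rewrite powRr0 mulr1.
Qed.

(** Compare the polar formula for |<a, x>|^p with the one for the constant 1,
    which gives the volume of the ball. The linear form x_1 serves to show that
    [Gam p] is positive, since <a, x> may vanish. *)
Lemma lp_ball_moment p a S : 1 <= p -> product_mean w (abs_pow p) a = S%:E ->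
  [/\ 0 < Gam 0, 0 < Gam p &
      (\int[P]_t (abs_pow p (lincomb a X t))%:E = (Gam 0 / Gam p * S)%:E)%E].
Proof.
move=> p1 ES.
have E1 : (\int[lam]_x ((fun=> 1) x * product_density w x)%:E = 1%:E)%E.
  by rewrite -(product_mean_const0 W (lexx 0) n.+1 admissible1).
have [u [u0 G0 GE Ku U]] := @lp_ball_mean R q hq n.+1 0 (fun=> 1) 1
  (measurable_cst _) (fun=> ler01) (fun s x _ => esym (etrans (mulr1 _) (powRr0 s))) ltr01 E1.
have [v [v0 Gp GpE _ _]] := @lp_ball_mean R q hq n.+1 p _ _ (mf p _) (f_ge0 p _)
  (@f_scale p _) (abs_moment_gt0 (le_trans ler01 p1) hq)
  (product_mean_abs_pow_coordinate n hq p1).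
have lamK : lam K = u%:E.
  rewrite -Ku integral_cst ?mul1e//; exact: measurable_lp_ball.
rewrite -!GamE in G0 Gp U.
split=> //.
have := uniform_integral hq hX u0 lamK (mf p a) (f_ge0 p a).
have := product_mean_lp_ball hq (mf p a) (f_ge0 p a) (@f_scale p a).
rewrite -[X in X = _ -> _]/(product_mean w (abs_pow p) a) ES GpE -GamE.
set I := (\int[lam]_(x in K) _)%E; set Z := _ ^+ n.+1 in U *.
have Z0 : 0 < Z by rewrite exprn_gt0// invr_gt0 lq_mass_gt0.
have I0 : (0 <= I)%E by apply: integral_ge0 => x _; rewrite lee_fin.
case: I I0 => [I| |] // I0; last by rewrite gt0_muley ?lte_fin// gt0_mulye ?lte_fin.
rewrite -!EFinM => -[SE].
have J0 : (0 <= \int[P]_t (f p a (X t))%:E)%E.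
  by apply: integral_ge0 => t _; rewrite lee_fin.
change (\int[P]_t (abs_pow p (lincomb a X t))%:E)%E with (\int[P]_t (f p a (X t))%:E)%E.
case: (\int[P]_t (f p a (X t))%:E)%E J0 => [J| |] // _; last by rewrite gt0_muley ?lte_fin.
rewrite -EFinM => -[JE]; congr EFin.
apply: (mulfI (lt0r_neq0 u0)); rewrite JE SE.
have -> : u * (Gam 0 / Gam p * (Z * I * Gam p)) = Z * u * Gam 0 * I.
  by field; rewrite gt_eqF.
by rewrite -U mul1r.
Qed.

Lemma rnorm_lincomb p a S : 1 <= p -> product_mean w (abs_pow p) a = S%:E ->
  0 < beta_cst p q n.+1 /\ rnorm P p (lincomb a X) = (beta_cst p q n.+1 * S `^ p^-1)%:E.
Proof.
move=> p1 ES; have [G0 Gp E] := lp_ball_moment p1 ES.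
have S0 : 0 <= S.
  rewrite -lee_fin -ES; apply: integral_ge0 => x _.
  rewrite lee_fin mulr_ge0 ?powR_ge0//.
  by apply: prodr_ge0 => i _; exact: weight_ge0 W _.
have bE : beta_cst p q n.+1 = (Gam 0 / Gam p) `^ p^-1.
  rewrite /Gam (addr0 (n.+1%:R : R)) /beta_cst.
  reflexivity.
have GG : 0 < Gam 0 / Gam p by exact: divr_gt0.
rewrite bE; split; first exact: powR_gt0.
rewrite -(powRM _ (ltW GG) S0) -poweR_EFin -E /rnorm unlock.
by [].
Qed.

End lp_ball_moments.

Section constants.
Context {R : realType}.
Implicit Types (q : \bar R) (p V M S : R).

Lemma powR_root V M p : 0 <= V -> 0 <= M -> 0 < p ->
  (V `^ p * M) `^ p^-1 = V * M `^ p^-1.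
Proof.
move=> V0 M0 p0; rewrite powRM ?powR_ge0// -powRrM mulfV ?gt_eqF//.
by rewrite powRr1.
Qed.

Lemma Gamma_gauss_ge0 p : 0 <= Gamma ((p + 1) / 2 : R).
Proof. by rewrite Gamma_gamma_integral fine_ge0 ?gamma_integral_ge0. Qed.

Lemma gauss_abs_moment_root q p : (2%:E <= q)%E -> 1 <= p ->
  gauss_abs_moment q p `^ p^-1 = abs_moment 2 q `^ 2^-1 * gamma_cst p.
Proof.
move=> hq p1; have p0 : 0 < p by lra.
have m0 := second_moment_gt0 hq.
have s0 : 0 < Num.sqrt (2 * second_moment q) by rewrite sqrtr_gt0 mulr_gt0.
rewrite /gauss_abs_moment gauss_weight_moment ?invr_gt0// invrK.
rewrite powR_root ?(ltW s0)//; last by rewrite divr_ge0 ?Gamma_gauss_ge0.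
rewrite -second_momentE powR12_sqrt ?(ltW m0)// sqrtrM//.
by rewrite /gamma_cst; ring.
Qed.

Lemma gauss_abs_moment_ge0 q p : (2%:E <= q)%E -> 0 <= gauss_abs_moment q p.
Proof.
move=> hq; apply: Rintegral_ge0 => x _; rewrite mulr_ge0 ?powR_ge0//.
apply: weight_ge0; apply: gauss_weightP.
by rewrite invr_gt0 sqrtr_gt0 mulr_gt0// second_moment_gt0.
Qed.

End constants.

(** * Moment comparison for the uniform distribution on the ball *)

Lemma coord_ratio_cancel {R : realType} (b c m2 mp V : R) : c != 0 -> m2 != 0 ->
  b * mp / (c * m2) * (c * (V * m2)) = b * (V * mp).
Proof. by move=> c0 m20; field; rewrite c0 m20. Qed.

Lemma gaussian_ratio_cancel {R : realType} (b c g m V : R) : c != 0 ->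
  b / c * g * (c * (V * m)) = b * (V * (m * g)).
Proof. by move=> c0; field. Qed.

Section khinchin.
Context {R : realType} d (T : measurableType d) (P : probability T R).
Variables (q : \bar R) (n : nat) (X : {RV P >-> Rn R n.+1}).
Hypothesis hq : (2%:E <= q)%E.
Hypothesis hX : uniformly_distributed X (lp_ball q n.+1).
Variables (p : R) (hp : 1 <= p).
Local Notation b := (beta_cst p q n.+1).
Local Notation b2 := (beta_cst 2 q n.+1).
Local Notation mp := (abs_moment p q `^ p^-1).
Local Notation m2 := (abs_moment 2 q `^ 2^-1).
Local Notation e0 := (fun i : 'I_n.+1 => (i == ord0)%:R : R).

Let p0 : 0 < p. Proof. exact: lt_le_trans hp. Qed.

Let m20 : 0 < m2.
Proof. by apply: powR_gt0; apply: abs_moment_gt0. Qed.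

Let V0 (a : 'I_n.+1 -> R) : 0 <= euclidean_norm a. Proof. exact: sqrtr_ge0. Qed.

Lemma rnorm2_lincomb a :
  0 < b2 /\ rnorm P 2 (lincomb a X) = (b2 * (euclidean_norm a * m2))%:E.
Proof.
have [S [ES S1 _]] := moment_bounds_ge2 hq a (lexx 2).
have [|S' [ES' _ S2]] := @moment_bounds_le2 R q hq n.+1 a 2; first by rewrite lexx ler1n.
have SS : S' = S by move: ES'; rewrite ES => -[].
rewrite SS in S2.
have [b20 ->] := rnorm_lincomb hq hX (ler1n _ 2) ES; split=> //.
have -> : S = euclidean_norm a `^ 2 * abs_moment 2 q.
  by apply/eqP; rewrite eq_le S1 S2.
by rewrite powR_root// ltW// abs_moment_gt0.
Qed.

Lemma rnorm_coordinate : 0 < b /\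
  rnorm P p (coordinate X ord0) = (b * mp)%:E /\
  rnorm P 2 (coordinate X ord0) = (b2 * m2)%:E.
Proof.
have cE : coordinate X ord0 = lincomb e0 X.
  apply/funext => t; rewrite /lincomb big_ord_recl eqxx mul1r.
  by rewrite big1 ?addr0// => i _; rewrite mul0r.
have [b0 Ep] := rnorm_lincomb hq hX hp (product_mean_abs_pow_coordinate n hq hp).
have [_ E2] := rnorm_lincomb hq hX (ler1n R 2) (product_mean_abs_pow_coordinate n hq (ler1n R 2)).
split; first exact: b0.
by split; rewrite cE; [exact: Ep|exact: E2].
Qed.

Lemma coord_ratioE (hn : (0 < n.+1)%N) : coord_ratio p hn X = (b * mp / (b2 * m2))%:E.
Proof.
have [b20 _] := rnorm2_lincomb e0.
rewrite /coord_ratio (_ : Ordinal hn = ord0); last exact: val_inj.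
have [_ [-> ->]] := rnorm_coordinate.
by rewrite inver gt_eqF ?mulr_gt0.
Qed.

Lemma khinchin_ge2 a : 2 <= p -> exists N,
  [/\ rnorm P p (lincomb a X) = N%:E, b * (euclidean_norm a * mp) <= N &
      N <= b * (euclidean_norm a * (m2 * gamma_cst p))].
Proof.
move=> p2; have [S [ES S1 S2]] := moment_bounds_ge2 hq a p2.
have [b0 EN] := rnorm_lincomb hq hX hp ES.
have mpp : 0 <= abs_moment p q by rewrite ltW// abs_moment_gt0// ltW.
have gpp := gauss_abs_moment_ge0 p hq.
have VS : 0 <= euclidean_norm a `^ p * abs_moment p q by rewrite mulr_ge0 ?powR_ge0.
have VG : 0 <= euclidean_norm a `^ p * gauss_abs_moment q p by rewrite mulr_ge0 ?powR_ge0.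
exists (b * S `^ p^-1); split=> //.
  rewrite ler_wpM2l ?(ltW b0)// -powR_root//.
  by apply: ge0_ler_powR; rewrite ?nnegrE ?invr_ge0 ?(ltW p0)// (le_trans VS).
rewrite ler_wpM2l ?(ltW b0)// -gauss_abs_moment_root// -powR_root//.
by apply: ge0_ler_powR; rewrite ?nnegrE ?invr_ge0 ?(ltW p0)// (le_trans VS).
Qed.

Lemma khinchin_le2 a : p < 2 -> exists N,
  [/\ rnorm P p (lincomb a X) = N%:E, b * (euclidean_norm a * (m2 * gamma_cst p)) <= N &
      N <= b * (euclidean_norm a * mp)].
Proof.
move=> p2; have p12 : 1 <= p <= 2 by rewrite hp ltW.
have [S [ES S1 S2]] := moment_bounds_le2 hq a p12.
have [b0 EN] := rnorm_lincomb hq hX hp ES.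
have mpp : 0 <= abs_moment p q by rewrite ltW// abs_moment_gt0// ltW.
have gpp := gauss_abs_moment_ge0 p hq.
have VS : 0 <= euclidean_norm a `^ p * abs_moment p q by rewrite mulr_ge0 ?powR_ge0.
have VG : 0 <= euclidean_norm a `^ p * gauss_abs_moment q p by rewrite mulr_ge0 ?powR_ge0.
exists (b * S `^ p^-1); split=> //.
  rewrite ler_wpM2l ?(ltW b0)// -gauss_abs_moment_root// -powR_root//.
  by apply: ge0_ler_powR; rewrite ?nnegrE ?invr_ge0 ?(ltW p0)// (le_trans VG).
rewrite ler_wpM2l ?(ltW b0)// -powR_root//.
by apply: ge0_ler_powR; rewrite ?nnegrE ?invr_ge0 ?(ltW p0)// (le_trans VG).
Qed.

Lemma coord_ratio_scale (a : 'I_n.+1 -> R) : b * mp / (b2 * m2) * (b2 * (euclidean_norm a * m2)) =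
  b * (euclidean_norm a * mp).
Proof.
have [b20 _] := rnorm2_lincomb e0.
exact: coord_ratio_cancel (lt0r_neq0 b20) (lt0r_neq0 m20).
Qed.

Lemma gaussian_ratio_scale (a : 'I_n.+1 -> R) :
  b / b2 * gamma_cst p * (b2 * (euclidean_norm a * m2)) =
  b * (euclidean_norm a * (m2 * gamma_cst p)).
Proof.
have [b20 _] := rnorm2_lincomb e0.
exact: gaussian_ratio_cancel (lt0r_neq0 b20).
Qed.

Lemma khinchin_bounds (hn : (0 < n.+1)%N) a :
  (A_cst p q hn X * rnorm P 2 (lincomb a X) <= rnorm P p (lincomb a X) /\
   rnorm P p (lincomb a X) <= B_cst p q hn X * rnorm P 2 (lincomb a X))%E.
Proof.
have [_ ->] := rnorm2_lincomb a.
rewrite /A_cst /B_cst coord_ratioE /gaussian_ratio.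
have [p2|p2] := ltP p 2.
  have [N [-> N1 N2]] := khinchin_le2 a p2.
  by rewrite -!EFinM !lee_fin coord_ratio_scale gaussian_ratio_scale.
have [N [-> N1 N2]] := khinchin_ge2 a p2.
by rewrite -!EFinM !lee_fin coord_ratio_scale gaussian_ratio_scale.
Qed.

Lemma coord_ratio_extremal (hn : (0 < n.+1)%N) (C : R) :
  ((C%:E * rnorm P 2 (lincomb (fun i => (i == ord0)%:R) X) <=
    rnorm P p (lincomb (fun i => (i == ord0)%:R) X) -> C%:E <= coord_ratio p hn X) /\
   (rnorm P p (lincomb (fun i => (i == ord0)%:R) X) <=
    C%:E * rnorm P 2 (lincomb (fun i => (i == ord0)%:R) X) -> coord_ratio p hn X <= C%:E))%E.
Proof.
have [b20 _] := rnorm2_lincomb e0.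
have cE : lincomb (fun i => (i == ord0)%:R) X = coordinate X ord0.
  apply/funext => t; rewrite /lincomb big_ord_recl eqxx mul1r.
  by rewrite big1 ?addr0// => i _; rewrite mul0r.
have bm : 0 < b2 * m2 by rewrite mulr_gt0.
rewrite cE coord_ratioE; have [_ [-> ->]] := rnorm_coordinate.
rewrite -EFinM !lee_fin.
by split=> H; [rewrite (ler_pdivlMr _ _ bm)|rewrite (ler_pdivrMr _ _ bm)]; exact: H.
Qed.

End khinchin.

Local Open Scope ereal_scope.

Theorem corollary3 (R : realType) (q : \bar R) (hq : 2%:E <= q)
    (n : nat) (hn : (0 < n)%N)
    (d : measure_display) (T : measurableType d) (P : probability T R)
    (X : {RV P >-> Rn R n})
    (hX : uniformly_distributed X (lp_ball q n))
    (p : R) (hp : (1 <= p)%R) :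
  (forall a : 'I_n -> R,
     A_cst p q hn X * rnorm P 2 (lincomb a X) <= rnorm P p (lincomb a X) /\
     rnorm P p (lincomb a X) <= B_cst p q hn X * rnorm P 2 (lincomb a X)) /\
  ((2 <= p)%R -> forall C : R,
     (forall a : 'I_n -> R,
        C%:E * rnorm P 2 (lincomb a X) <= rnorm P p (lincomb a X)) ->
     C%:E <= A_cst p q hn X) /\
  ((p < 2)%R -> forall C : R,
     (forall a : 'I_n -> R,
        rnorm P p (lincomb a X) <= C%:E * rnorm P 2 (lincomb a X)) ->
     B_cst p q hn X <= C%:E).
Proof.
case: n hn X hX => [//|n'] hn' X' hX'.
split; first by move=> a; exact: khinchin_bounds.
split=> [p2|p2] C hC.
  rewrite /A_cst ltNge p2/=.
  by apply: (proj1 (coord_ratio_extremal hq hX' hp hn' C)); exact: hC.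
rewrite /B_cst p2.
by apply: (proj2 (coord_ratio_extremal hq hX' hp hn' C)); exact: hC.
Qed.
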